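(* Let $n\ge1$ and let $\bm{N}=(N_0,N_1,\ldots,N_n)\in\mathbb{Z}^{n+1}$ be such that $\mathcal{F}_n(\bm{N})$ is non-empty, and let $s_k=\sum_{j=0}^k N_j$ for all $k$. Then \[ \sup_{\bm{f}\in\mathcal{F}_n(\bm{N})} e^{\mathcal{H}(\bm{f})} \;\geq\; K_n(\bm{N}) \;\geq\; \frac{\max_{0\le k\le n-1}\{e^{h(s_k)}\}}{\left(\prod_{k=0}^{n-1} e^{h(s_k)}\right)^2}\,\sup_{\bm{f}\in\mathcal{F}_n(\bm{N})} e^{\mathcal{H}(\bm{f})}. \]
   Context: $\mathcal{F}_n(\bm{N})$ is the set of $\bm{f}=(f_{ij})_{0\le i<j\le n}\in\mathbb{R}_{\ge0}^{\binom{n+1}{2}}$ with $\sum_{j>i} f_{ij}-\sum_{k<i} f_{ki}=N_i$ for every $i\in\{0,\ldots,n\}$ (flows on the complete directed graph on $\{0,\ldots,n\}$, edges $i\to j$ for $i<j$, with netflow $\bm{N}$), and $K_n(\bm{N})$ is its number of integer points. Let $h(t):=(t+1)\log(t+1)-t\log t$ for $t\ge0$ (with $0\log 0=0$). The flow entropy of $\bm{f}\in\mathcal{F}_n(\bm{N})$ is \[ \mathcal{H}(\bm{f}):=\sum_{0\le i<j\le n} h(f_{ij})+\sum_{0<j<n} h\Big(\sum_{0\le i<j}(N_i-f_{ij})\Big). \] *)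

(* Defs.v *)
From HB Require Import structures.
From mathcomp Require Import all_boot all_order all_algebra.
From mathcomp Require Import finmap.
From mathcomp Require Import all_classical all_reals all_analysis.
Set Implicit Arguments. Unset Strict Implicit. Unset Printing Implicit Defensive.
Import Order.TTheory GRing.Theory Num.Theory.
Local Open Scope classical_set_scope.
Local Open Scope ring_scope.

Section FlowDefs.
Variable R : realType.

(* h(t) = (t+1) log(t+1) - t log t ; at t = 0 the term t*log t is 0 * ln 0 = 0,
   matching the convention 0 log 0 = 0. *)
Definition hfun (t : R) : R := (t + 1) * ln (t + 1) - t * ln t.

(* A flow on the complete DAG on {0..n}: a function on pairs (i,j),
   required to vanish off the edges i<j (so it is a vector indexed by edges). *)
Definition netflow_ok (n : nat) (N : 'I_n.+1 -> int)
  (f : {ffun 'I_n.+1 * 'I_n.+1 -> R}) : Prop :=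
  (forall i j : 'I_n.+1, ~~ (i < j)%N -> f (i, j) = 0) /\
  (forall i j : 'I_n.+1, (i < j)%N -> 0 <= f (i, j)) /\
  (forall i : 'I_n.+1,
     \sum_(j < n.+1 | (i < j)%N) f (i, j) - \sum_(k < n.+1 | (k < i)%N) f (k, i)
     = (N i)%:~R).

Definition flows (n : nat) (N : 'I_n.+1 -> int) :
  set {ffun 'I_n.+1 * 'I_n.+1 -> R} := [set f | netflow_ok N f].

Definition Kn (n : nat) (N : 'I_n.+1 -> int) : nat :=
  #|` fset_set [set g : {ffun 'I_n.+1 * 'I_n.+1 -> int} |
                 flows N [ffun e => (g e)%:~R]] |.

Definition flow_entropy (n : nat) (N : 'I_n.+1 -> int)
  (f : {ffun 'I_n.+1 * 'I_n.+1 -> R}) : R :=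
  \sum_(i < n.+1) \sum_(j < n.+1 | (i < j)%N) hfun (f (i, j))
  + \sum_(j < n.+1 | (0 < j < n)%N)
      hfun (\sum_(i < n.+1 | (i < j)%N) ((N i)%:~R - f (i, j))).

Definition spart (n : nat) (N : 'I_n.+1 -> int) (k : nat) : int :=
  \sum_(j < n.+1 | (j <= k)%N) N j.

End FlowDefs.

(* Main.v *)
(* A flow corresponds to an n x n nonnegative table supported on i <= j + 1 whose
   i-th row and i-th column both sum to s_i (the subdiagonal cells are the slacks
   occurring in the entropy), and H becomes the sum of h over all cells.

   Upper bound: Gibbs' inequality for the uniform law on integer tables against
   independent geometric laws with the same means.

   Lower bound: free the margins one at a time.  When the weighted number c_k of
   tables whose current margin equals k is log-concave in k, some t > 0 satisfies
   sum_k c_k t^k <= e^(h b) t^b c_b, so each freed margin costs a factor e^(h b)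
   (the first one is free, as the total is fixed), and with all margins free one
   compares cell by cell via e^(h f) t^f <= 1 / (1 - t).

   Log-concavity comes from an elementary Lorentzian property of positive arrays
   c : N^V -> R: all matrices (c (nu + e_i + e_j))_ij are hyperbolic.  It holds
   for products of log-concave sequences, and it is preserved by
   c' nu = sum_b w^b c (nu + b e_x - b e_y), which creates one cell of the table.
   Indeed c' (nu + e_y) = c (nu + e_y) + w c' (nu + e_x), and in the
   corresponding sum B = A + w A' of hyperbolic matrices B e_x = A' e_y. *)

Require Import Defs.
From HB Require Import structures.
From mathcomp Require Import all_boot all_order all_algebra.
From mathcomp Require Import finmap.
From mathcomp Require Import all_classical all_reals all_analysis.
From mathcomp Require Import ring lra zify.
Import Order.TTheory GRing.Theory Num.Theory.
Local Open Scope classical_set_scope.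
Local Open Scope ring_scope.
Set Implicit Arguments.
Unset Strict Implicit.
Unset Printing Implicit Defensive.

(** * Hyperbolic matrices *)

Section Hyperbolic.
Variables (R : realType) (V : finType).
Implicit Types (A : V -> V -> R) (y z : V -> R).

Definition bil A z y : R := \sum_i \sum_j z i * y j * A i j.

Definition ev (x : V) : V -> R := fun v => (v == x)%:R.

(** A reversed Cauchy-Schwarz inequality; for symmetric [A] it says that [A] has at most one
    positive eigenvalue. *)
Definition hyperbolic A : Prop :=
  forall z y, 0 < bil A y y -> bil A z z * bil A y y <= bil A z y ^+ 2.

Lemma bil_combl A (p r : R) z y u :
  bil A (fun i => p * z i + r * y i) u = p * bil A z u + r * bil A y u.
Proof.
rewrite /bil !mulr_sumr -big_split; apply: eq_bigr => i _ /=.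
by rewrite !mulr_sumr -big_split; apply: eq_bigr => j _ /=; ring.
Qed.

Lemma bilC A z y : (forall i j, A i j = A j i) -> bil A z y = bil A y z.
Proof.
move=> sA; rewrite /bil exchange_big; apply: eq_bigr => i _ /=.
by apply: eq_bigr => j _; rewrite sA; ring.
Qed.

Lemma bil_combr A (p r : R) z y u : (forall i j, A i j = A j i) ->
  bil A u (fun i => p * z i + r * y i) = p * bil A u z + r * bil A u y.
Proof. by move=> sA; rewrite !(bilC u) // bil_combl. Qed.

Lemma bil_evr A z x : bil A z (ev x) = \sum_i z i * A i x.
Proof.
apply: eq_bigr => i _; rewrite (bigD1 x) //= big1 => [|j /negPf jx].
  by rewrite /ev eqxx mulr1 addr0.
by rewrite /ev jx mulr0 mul0r.
Qed.

Lemma bil_ev A (x y : V) : bil A (ev x) (ev y) = A x y.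
Proof.
rewrite bil_evr (bigD1 x) //= big1 => [|j /negPf jx].
  by rewrite /ev eqxx mul1r addr0.
by rewrite /ev jx mul0r.
Qed.

Lemma bil_lin A A' (w : R) z y :
  bil (fun i j => A i j + w * A' i j) z y = bil A z y + w * bil A' z y.
Proof.
rewrite /bil mulr_sumr -big_split; apply: eq_bigr => i _ /=.
by rewrite mulr_sumr -big_split; apply: eq_bigr => j _ /=; ring.
Qed.

Lemma eq_bil A A' z y : (forall i j, A i j = A' i j) -> bil A z y = bil A' z y.
Proof.
by move=> e; apply: eq_bigr => i _; apply: eq_bigr => j _; rewrite e.
Qed.

Definition lfun (L : (V -> R) -> R) : Prop :=
  forall p r z y, L (fun i => p * z i + r * y i) = p * L z + r * L y.

(* The combination [v = L y *: z - L z *: y] lies in the kernel of [L], so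
   [bil A v v <= 0]; expanding this gives the reversed Cauchy-Schwarz. *)
Lemma hyperbolic_ker A L : (forall i j, A i j = A j i) -> lfun L ->
  (forall z, L z = 0 -> bil A z z <= 0) -> hyperbolic A.
Proof.
move=> sA linL neg z y y0.
set p := L y; set r := L z.
have p0 : p != 0 by apply/eqP => /neg; rewrite leNgt y0.
have : L (fun i => p * z i + (- r) * y i) = 0.
  by rewrite linL -/p -/r; ring.
move/neg; rewrite bil_combl !bil_combr // (bilC y z) // => vv.
have p2 : 0 < p ^+ 2 by rewrite exprn_even_gt0.
rewrite -(ler_pM2l p2) -subr_ge0.
have {}vv := mulr_le0_ge0 vv (ltW y0).
have sq := sqr_ge0 (r * bil A y y - p * bil A z y).
have e : (r * bil A y y - p * bil A z y) ^+ 2 =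
  (p * (p * bil A z z + - r * bil A z y) + - r * (p * bil A z y + - r * bil A y y)) * bil A y y
  + (p ^+ 2 * bil A z y ^+ 2 - p ^+ 2 * (bil A z z * bil A y y)) by ring.
move: sq; rewrite e => sq; lra.
Qed.

Lemma hyperbolic_orth A x0 : (forall i j, A i j = A j i) ->
  (forall z, bil A z x0 = 0 -> bil A z z <= 0) -> hyperbolic A.
Proof.
by move=> sA; apply: (@hyperbolic_ker A (bil A ^~ x0)) => // p r z y; rewrite bil_combl.
Qed.

(** A vector [z] that is [B]-orthogonal to [ev x] is [A']-orthogonal to [ev y]. Reversed
    Cauchy-Schwarz for [A] at [ev x] and for [A'] at [ev y] then bounds the two parts of [bil B z z]
    by opposite quantities. *)
Lemma hyperbolic_transfer (A A' B : V -> V -> R) (w : R) (x y : V) :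
  (forall i j, A i j = A j i) -> (forall i j, A' i j = A' j i) ->
  hyperbolic A -> hyperbolic A' -> 0 < w ->
  0 < A x x -> 0 < A x y -> 0 < A' x y ->
  (forall i j, B i j = A i j + w * A' i j) -> (forall i, B x i = A' y i) ->
  hyperbolic B.
Proof.
move=> sA sA' hA hA' w0 Axx Axy A'xy eB eBx.
have sB i j : B i j = B j i by rewrite !eB sA sA'.
apply: (@hyperbolic_orth B (ev x)) => // z Bzx.
have bB u v : bil B u v = bil A u v + w * bil A' u v.
  by rewrite -bil_lin; apply: eq_bil.
have A'zy : bil A' z (ev y) = 0.
  by rewrite -Bzx !bil_evr; apply: eq_bigr => i _; rewrite sA' -eBx sB.
have Azx : bil A z (ev x) = - (w * bil A' z (ev x)).
  by move: Bzx; rewrite bB => /eqP; rewrite addr_eq0 => /eqP.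
have A'yy : A' y y = A x y + w * A' x y by rewrite -eBx eB.
have Bxx : A x x + w * A' x x = A' x y by rewrite -eB eBx sA'.
have A'yy0 : 0 < A' y y by rewrite A'yy addr_gt0 ?mulr_gt0.
set t := bil A' z (ev x) in Azx.
have := hA z (ev x); rewrite !bil_ev Azx => /(_ Axx) h1.
(* This [l] makes [z + l ev x] orthogonal to [ev x] for [A], and it minimises the bound
   [l ^+ 2 * A x x - 2 * l * w * t] that results for [w * a']. *)
pose l := w * t / A x x.
have := hA' (fun i => 1 * z i + l * ev x i) (ev y).
rewrite !bil_combl !bil_combr // (bilC (ev x) z) // !bil_ev A'zy -/t.
move=> /(_ A'yy0) h2.
rewrite bB.
set a := bil A z z in h1 *; set a' := bil A' z z in h2 *.
have lA : l * A x x = w * t by rewrite /l divfK // gt_eqF.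
have h3 : w * (a' + 2 * l * t + l ^+ 2 * A' x x) <= l ^+ 2 * A' x y.
  rewrite -(ler_pM2r A'yy0).
  have -> : l ^+ 2 * A' x y * A' y y =
    w * (l * A' x y) ^+ 2 + l ^+ 2 * A' x y * A x y by rewrite A'yy; ring.
  have n : 0 <= l ^+ 2 * A' x y * A x y.
    exact: mulr_ge0 (mulr_ge0 (sqr_ge0 _) (ltW _)) (ltW _).
  have : w * ((a' + 2 * l * t + l ^+ 2 * A' x x) * A' y y)
     <= w * (l * A' x y) ^+ 2.
    rewrite ler_pM2l //; apply: le_trans (le_trans _ h2) _.
      by rewrite le_eqVlt; apply/orP; left; apply/eqP; ring.
    by rewrite le_eqVlt; apply/orP; left; apply/eqP; ring.

  by move=> h; rewrite -mulrA; lra.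
have h4 : w * a' <= - (l * (w * t)).
  have e : l ^+ 2 * A' x y = l * (l * A x x) + w * l ^+ 2 * A' x x.
    by rewrite -Bxx; ring.
  by move: h3; rewrite e lA => h3; lra.
have h5 : a <= l * (w * t).
  rewrite -(ler_pM2r Axx); apply: (le_trans h1).
  by rewrite mulrAC lA le_eqVlt; apply/orP; left; apply/eqP; ring.
lra.
Qed.

End Hyperbolic.

(** * Lorentzian arrays *)

Section LorentzianArrays.
Variables (R : realType) (V : finType).
Implicit Types (c : (V -> nat) -> R) (nu : V -> nat).

Definition incr nu (x : V) : V -> nat := fun v => (nu v + (v == x))%N.

Definition hess c nu (i j : V) : R := c (incr (incr nu i) j).

(* The coefficients [c] are normalised by factorials: [hess c nu] is the matrix
   of the quadratic form obtained by applying the derivation of multidegree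
   [nu] to the polynomial [\sum_mu c mu X^mu / mu!]. *)
Definition lorentzian c : Prop :=
  (forall nu, 0 < c nu) /\ (forall nu, hyperbolic (hess c nu)).

(** Here [b] units move from [y] to [x]; as [b <= nu y], the truncated subtraction is exact. *)
Definition transfer (x y : V) (w : R) c nu : R :=
  \sum_(b < (nu y).+1)
    w ^+ b * c (fun v => nu v + b * (v == x) - b * (v == y))%N.

Lemma incrC nu x y : incr (incr nu x) y = incr (incr nu y) x.
Proof. by apply: funext => v; rewrite /incr addnAC. Qed.

Lemma hessC c nu i j : hess c nu i j = hess c nu j i.
Proof. by rewrite /hess incrC. Qed.

Lemma transfer0 x y w c nu : nu y = 0%N -> transfer x y w c nu = c nu.
Proof.
move=> e; rewrite /transfer e big_ord1 expr0 mul1r; congr c.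
by apply: funext => v; rewrite !mul0n subn0 addn0.
Qed.

(** Either nothing moves, or a first unit moves at cost [w] and turns [nu + e_y] into [nu + e_x]. *)
Lemma transfer_incr x y w c nu : x != y ->
  transfer x y w c (incr nu y) = c (incr nu y) + w * transfer x y w c (incr nu x).
Proof.
move=> xy; rewrite /transfer /incr eqxx addn1 big_ord_recl /=; congr (_ + _).
  rewrite expr0 mul1r; congr c.
  by apply: funext => v; rewrite !mul0n subn0 addn0.
rewrite eq_sym (negPf xy) addn0 mulr_sumr; apply: eq_bigr => b _ /=.
rewrite mulrA -exprS; congr (_ * c _).
apply: funext => v; rewrite /bump /= add1n.
by case: (v == x); case: (v == y); rewrite !(muln0, muln1, addn0, addn1, subn0); lia.
Qed.

Lemma transfer_gt0 x y w c nu : 0 < w -> (forall nu, 0 < c nu) ->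
  0 < transfer x y w c nu.
Proof.
move=> w0 c0; rewrite /transfer big_ord_recl /=.
apply: ltr_pwDl; first by rewrite expr0 mul1r.
by apply: sumr_ge0 => i _; rewrite mulr_ge0 ?exprn_ge0 // ltW.
Qed.

(** [A'] is the pullback of [A] along [z |-> z + w z_y e_x], minus a multiple of the square of
    [z y]. *)
Lemma bil_transfer (A A' : V -> V -> R) (w : R) x y z :
  (forall i j, A i j = A j i) ->
  (forall i j, A' i j = A i j + w * ((i == y)%:R * A x j + (j == y)%:R * A i x)
     + (i == y)%:R * (j == y)%:R * (w ^+ 2 * A x x - w * A x y)) ->
  bil A' z z = bil A (fun i => 1 * z i + (w * z y) * ev R x i)
                     (fun i => 1 * z i + (w * z y) * ev R x i)
               - w * A x y * z y ^+ 2.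
Proof.
move=> sA eA'.
have delta (F : V -> R) : \sum_i (i == y)%:R * F i = F y.
  rewrite (bigD1 y) //= eqxx mul1r big1 ?addr0 // => i /negPf ->.
  by rewrite mul0r.
rewrite bil_combl !bil_combr // (bilC (ev R x) z) // bil_ev bil_evr.
have -> : bil A' z z = bil A z z + (w * \sum_i (i == y)%:R * \sum_j (z i * z j * A x j)
   + w * \sum_i \sum_j (j == y)%:R * (z i * z j * A i x)
   + \sum_i (i == y)%:R * \sum_j (j == y)%:R * (z i * z j * (w ^+ 2 * A x x - w * A x y))).
  rewrite /bil !mulr_sumr -!big_split; apply: eq_bigr => i _ /=.
  rewrite !mulr_sumr -!big_split; apply: eq_bigr => j _ /=.
  by rewrite eA'; ring.
rewrite !delta; under [in X in _ + (_ + X + _)]eq_bigr => i _ do rewrite delta.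
have -> : \sum_j z y * z j * A x j = z y * \sum_i z i * A i x.
  by rewrite mulr_sumr; apply: eq_bigr => i _; rewrite sA mulrA.
have -> : \sum_i z i * z y * A i x = z y * \sum_i z i * A i x.
  by rewrite mulr_sumr; apply: eq_bigr => i _; rewrite mulrA (mulrC (z y)).
ring.
Qed.

(** At most two units can sit at [y], so only transfers of zero, one or two units occur. The last
    term corrects the entry [(y, y)], where the pullback counts the transfer of a single unit
    twice. *)
Lemma hess_transfer0 x y w c nu i j : x != y -> nu y = 0%N ->
  hess (transfer x y w c) nu i j =
  hess c nu i j + w * ((i == y)%:R * hess c nu x j + (j == y)%:R * hess c nu i x)
     + (i == y)%:R * (j == y)%:R * (w ^+ 2 * hess c nu x x - w * hess c nu x y).
Proof.
move=> xy nuy.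
have nx mu : mu y = 0%N -> incr mu x y = 0%N.
  by move=> e; rewrite /incr e eq_sym (negPf xy).
have hj k : transfer x y w c (incr nu k) =
    c (incr nu k) + w * ((k == y)%:R * c (incr nu x)).
  have [->|ky] := eqVneq k y.
    by rewrite transfer_incr // (transfer0 _ _ _ (nx _ nuy)) mul1r.
  by rewrite transfer0 ?mul0r ?mulr0 ?addr0 // /incr nuy eq_sym (negPf ky).
rewrite /hess.
have [->|jy] := eqVneq j y.
  rewrite transfer_incr // (incrC nu i x).
  have [->|iy] := eqVneq i y.
    rewrite transfer_incr // transfer0 ?nx ?nx //.
    by rewrite ?(incrC nu y x) ?mulr1n; ring.
  rewrite transfer0; last by rewrite /incr nuy eq_sym (negPf xy) eq_sym (negPf iy).
  by rewrite ?(incrC nu x i) ?mulr0n ?mulr1n; ring.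
rewrite incrC.
have [->|iy] := eqVneq i y.
  rewrite transfer_incr // transfer0; last first.
    by rewrite /incr nuy eq_sym (negPf jy) eq_sym (negPf xy).
  by rewrite ?(incrC nu x j) ?mulr0n ?mulr1n; ring.
rewrite transfer0; last by rewrite /incr nuy eq_sym (negPf jy) eq_sym (negPf iy).
by rewrite !mulr0n; ring.
Qed.

(** Induction on [nu y]. At zero the Hessian is a pullback of a hyperbolic form minus a nonnegative
    square; beyond, [transfer_incr] gives the situation of [hyperbolic_transfer], where [A'] is a
    Hessian with one unit less at [y]. *)
Lemma lorentzian_transfer x y w c : x != y -> 0 < w -> lorentzian c ->
  lorentzian (transfer x y w c).
Proof.
move=> xy w0 [c0 hc].
have t0 nu : 0 < transfer x y w c nu by apply: transfer_gt0.
split=> // nu; move e : (nu y) => m; elim: m nu e => [|m IHm] nu e.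
  pose s (z : V -> R) := fun i => 1 * z i + (w * z y) * ev R x i.
  apply: (@hyperbolic_ker _ _ _ (fun z => bil (hess c nu) (s z) (ev R x))).
  - exact: hessC.
  - move=> p r z u; rewrite /s !bil_combl; ring.
  - move=> z Lz; rewrite (@bil_transfer (hess c nu) _ w x y) //; last 2 first.
    + exact: hessC.
    + by move=> i j; apply: hess_transfer0.
    rewrite -/(s z) subr_le0.
    have := hc nu (s z) (ev R x); rewrite Lz bil_ev expr0n /= => /(_ (c0 _)) h.
    have {}h : bil (hess c nu) (s z) (s z) <= 0
      by rewrite -(pmulr_lle0 (bil _ _ _) (c0 (incr (incr nu x) x))).
    apply: (le_trans h); rewrite mulr_ge0 ?sqr_ge0 //.
    by rewrite mulr_ge0 ?ltW //; apply: c0.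
pose mu := fun v => (nu v - (v == y))%N.
have -> : nu = incr mu y.
  apply: funext => v; rewrite /incr /mu.
  by have [->|vy] := eqVneq v y; rewrite ?e ?subn0 ?addn0 // subn1 addn1.
have muy : mu y = m by rewrite /mu eqxx e subn1.
apply: (@hyperbolic_transfer _ _ (hess c (incr mu y))
   (hess (transfer x y w c) (incr mu x)) _ w x y) => //.
- exact: hessC.
- exact: hessC.
- by apply: IHm; rewrite /incr eq_sym (negPf xy) addn0.
- exact: c0.
- exact: c0.
- exact: t0.
- move=> i j; rewrite /hess -[incr (incr (incr mu y) i) j]/(incr _ _).
  rewrite (incrC mu y i) (incrC _ y j) transfer_incr //.
  by rewrite (incrC _ j x) (incrC mu i x).
- by move=> i; rewrite /hess (incrC mu y x).
Qed.

(** Up to the factor [P], the Hessian is the rank-one matrix [t i * t j] minus the diagonal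
    [t i ^+ 2 - s i], which log-concavity makes nonnegative; so the form is nonpositive wherever
    [\sum_i z i * t i] vanishes. *)
Lemma lorentzian_prod (u : V -> nat -> R) :
  (forall v m, 0 < u v m) ->
  (forall v m, u v m * u v m.+2 <= u v m.+1 ^+ 2) ->
  lorentzian (fun nu => \prod_v u v (nu v)).
Proof.
move=> u0 ulc; split=> [nu|nu]; first by apply: prodr_gt0.
pose t v := u v (nu v).+1 / u v (nu v).
pose s v := u v (nu v).+2 / u v (nu v).
pose P := \prod_v u v (nu v).
have P0 : 0 < P by apply: prodr_gt0.
have un v m : u v m != 0 by rewrite gt_eqF.
have st v : s v <= t v ^+ 2.
  have -> : s v = (u v (nu v) * u v (nu v).+2) / u v (nu v) ^+ 2.
    by rewrite /s; field; rewrite un.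
  by rewrite /t expr_div_n ler_pM2r ?invr_gt0 ?exprn_gt0.
have e i j : hess (fun nu => \prod_v u v (nu v)) nu i j
    = P * (t i * t j - (i == j)%:R * (t i ^+ 2 - s i)).
  rewrite /hess /P; have [<-|ij] := eqVneq i j.
    rewrite (bigD1 i) //= [in RHS](bigD1 i) //= /incr eqxx !addn1.
    rewrite (eq_bigr (fun v => u v (nu v))) => [|v /negPf ->]; last by rewrite !addn0.
    by rewrite mulr1n /s; field; rewrite un.
  rewrite (bigD1 i) //= [in RHS](bigD1 i) //=.
  have ji : j != i by rewrite eq_sym.
  rewrite (bigD1 j) //= [in RHS](bigD1 j) //= /incr !eqxx (negPf ji) (negPf ij).
  rewrite (eq_bigr (fun v => u v (nu v))) => [|v /andP[/negPf -> /negPf ->]];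
    last by rewrite !addn0.
  by rewrite !addn0 !addn1 mulr0n /t; field; rewrite !un.
apply: (@hyperbolic_ker _ _ _ (fun z => \sum_i z i * t i)).
- exact: hessC.
- move=> p r z y; rewrite !mulr_sumr -big_split; apply: eq_bigr => i _ /=; ring.
- move=> z Lz.
  have -> : bil (hess (fun nu => \prod_v u v (nu v)) nu) z z =
     P * ((\sum_i z i * t i) ^+ 2 - \sum_i z i ^+ 2 * (t i ^+ 2 - s i)).
    rewrite expr2 mulr_suml -sumrB mulr_sumr; apply: eq_bigr => i _.
    rewrite (bigD1 i) //= [in RHS](bigD1 i) //= e eqxx mulr1n.
    have -> : \sum_(j | j != i) z i * z j * hess (fun nu => \prod_v u v (nu v)) nu i j
        = P * (z i * t i * \sum_(j | j != i) z j * t j).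
      rewrite !mulr_sumr; apply: eq_bigr => j ji.
      by rewrite e eq_sym (negPf ji) mulr0n; ring.
    ring.
  rewrite Lz expr0n /= sub0r mulrN oppr_le0 mulr_ge0 ?(ltW P0) //.
  by apply: sumr_ge0 => i _; rewrite mulr_ge0 ?sqr_ge0 // subr_ge0.
Qed.

End LorentzianArrays.

(** * Log-concavity of table sums *)

Section LogConcave.
Variable R : realType.

(* On nonnegative sequences this is log-concavity without internal zeros. *)
Definition slc (c : nat -> R) (M : nat) : Prop :=
  forall i j, (i <= j)%N -> (j < M)%N -> c i * c j.+1 <= c i.+1 * c j.

Lemma pos_slc (c : nat -> R) M :
  (forall m, (m <= M)%N -> 0 < c m) ->
  (forall m, (m.+2 <= M)%N -> c m * c m.+2 <= c m.+1 ^+ 2) -> slc c M.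
Proof.
move=> c0 lc i j; elim: j => [|j IHj] ij jM.
  by move: ij; rewrite leqn0 => /eqP ->; rewrite mulrC.
move: ij; rewrite leq_eqVlt => /orP[/eqP ->|ij]; first by rewrite mulrC.
have {}IHj := IHj ij (ltnW jM).
have cj : 0 < c j by apply: c0; lia.
rewrite -(ler_pM2l cj).
have h1 : c i * (c j * c j.+2) <= c i * c j.+1 ^+ 2.
  by rewrite ler_pM2l ?lc ?c0; lia.
have h2 : c i * c j.+1 * c j.+1 <= c i.+1 * c j * c j.+1.
  by rewrite ler_pM2r ?c0 // ltnW.
have -> : c j * (c i * c j.+2) = c i * (c j * c j.+2) by ring.
apply: (le_trans h1); rewrite expr2 mulrA; apply: (le_trans h2).
by rewrite le_eqVlt; apply/orP; left; apply/eqP; ring.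
Qed.

(** Reversed Cauchy-Schwarz for [ev x] and [ev y] in the Hessian at [nu + m e_x + (M - m - 2) e_y]
    is the local log-concavity inequality. *)
Lemma lorentzian_slc (V : finType) (c : (V -> nat) -> R) (x y : V) nu M :
  lorentzian c -> x != y ->
  slc (fun m => c (fun v => nu v + m * (v == x) + (M - m) * (v == y))%N) M.
Proof.
move=> [c0 hc] xy; apply: pos_slc => [m _|m mM]; first exact: c0.
pose mu v := (nu v + m * (v == x) + (M - m.+2) * (v == y))%N.
have := hc mu (ev R x) (ev R y); rewrite !bil_ev /hess => /(_ (c0 _)).
rewrite mulrC.
have e (n : nat) k : (forall v, (nu v + n * (v == x) + (M - n) * (v == y))%N = k v) ->
   c (fun v => nu v + n * (v == x) + (M - n) * (v == y))%N = c k.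
  by move=> h; congr c; apply: funext.
rewrite (e m (incr (incr mu y) y)) ?(e m.+1 (incr (incr mu x) y)) ?(e m.+2 (incr (incr mu x) x)) //.
- move=> v; rewrite /incr /mu; case: (v == x); case: (v == y); lia.
- move=> v; rewrite /incr /mu; case: (v == x); case: (v == y); lia.
- move=> v; rewrite /incr /mu; case: (v == x); case: (v == y); lia.
Qed.

Lemma horner0_ge0 (p : {poly R}) :
  (forall x, 0 < x -> x < 1 -> 0 <= p.[x]) -> 0 <= p.[0].
Proof.
move=> p0; have cv : horner p x @[x --> 0^'+] --> p.[0].
  by apply: cvg_at_right_filter; exact: continuous_horner.
apply: (cvgr_to_ge cv); near=> x; apply: p0; near: x.
- exact: nbhs_right_gt.
- exact: nbhs_right_lt.
Unshelve. all: by end_near. Qed.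

End LogConcave.

(** * Tables as successive transfers, one for each cell *)

Section Tables.
Variables (R : realType) (E V : finType) (s t : E -> V) (B : nat).
Hypothesis st : forall e e', s e != t e'.
Local Notation table := {ffun E -> 'I_B.+1}.
Implicit Types (a : table) (w : E -> R) (nu : V -> nat).

Definition outflow a (v : V) : nat := \sum_(e | s e == v) a e.
Definition inflow a (v : V) : nat := \sum_(e | t e == v) a e.

Definition supp_in (l : seq E) a := [forall e, (e \in l) || (a e == ord0)].

Definition upd a e (b : 'I_B.+1) : table := [ffun e' => if e' == e then b else a e'].

Lemma sum_supp_cons (F : table -> R) e l : e \notin l ->
  \sum_(a | supp_in (e :: l) a) F a =
  \sum_(b < B.+1) \sum_(a | supp_in l a) F (upd a e b).
Proof.
move=> el; rewrite (partition_big (fun a : table => a e) xpredT) //=.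
apply: eq_bigr => b _.
rewrite (reindex_onto (fun a => upd a e b) (fun a => upd a e ord0)); last first.
  move=> a /andP[_ /eqP ab]; apply/ffunP => e'; rewrite !ffunE.
  by case: eqP => // ->.
apply: eq_bigl => a; apply/idP/idP.
  move=> /andP[/andP[/forallP sa _] /eqP ua]; apply/forallP => e'.
  have := sa e'; rewrite -ua !ffunE inE.
  by case: eqP => [->|_] /=; rewrite ?eqxx ?orbT.
move=> /forallP sa; apply/andP; split; last first.
  apply/eqP/ffunP => e'; rewrite !ffunE; case: eqP => // ->.
  by have := sa e; rewrite (negPf el) => /eqP.
rewrite ffunE !eqxx andbT; apply/forallP => e'; rewrite inE ffunE.
by case: eqP => //= _; exact: sa.
Qed.

Lemma flow_upd (f : E -> V) a e b v : a e = ord0 ->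
  (\sum_(e' | f e' == v) upd a e b e' = \sum_(e' | f e' == v) a e' + b * (v == f e))%N.
Proof.
move=> ae; have [->|vfe] := eqVneq v (f e).
  rewrite (bigD1 e) //= [in RHS](bigD1 e) //= ffunE eqxx ae muln1 add0n addnC.
  congr (_ + _)%N; apply: eq_bigr => e' /andP[_ /negPf e'e]; by rewrite ffunE e'e.
rewrite muln0 addn0; apply: eq_bigr => e' /eqP fe'; rewrite ffunE.
by case: eqP => // e'e; move: vfe; rewrite -fe' e'e eqxx.
Qed.

Definition weight w a : R := \prod_e w e ^+ a e.

Lemma weight_upd w a e b : a e = ord0 ->
  weight w (upd a e b) = w e ^+ b * weight w a.
Proof.
move=> ae; rewrite /weight (bigD1 e) //= [in RHS](bigD1 e) //= ffunE eqxx ae.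
rewrite expr0 mul1r; congr (_ * _); apply: eq_bigr => e' /negPf e'e.
by rewrite ffunE e'e.
Qed.

Definition transfers w (l : seq E) (c : (V -> nat) -> R) : (V -> nat) -> R :=
  foldr (fun e => transfer (s e) (t e) (w e)) c l.

(** Under this condition the truncated subtraction in [moved] is exact. *)
Definition admissible nu a := [forall v, inflow a v <= nu v]%N.

Definition moved nu a : V -> nat := fun v => (nu v + outflow a v - inflow a v)%N.

Lemma inflow_source a e : inflow a (s e) = 0%N.
Proof. by rewrite /inflow big_pred0 // => e'; rewrite eq_sym (negPf (st _ _)). Qed.

Lemma outflow_target a e : outflow a (t e) = 0%N.
Proof. by rewrite /outflow big_pred0 // => e'; rewrite (negPf (st _ _)). Qed.

(** No source is a target, so a transfer never refills a vertex that another one draws from; the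
    successive conditions on the transfers thus amount to one condition on the total inflow. *)
Lemma transfers_supp w l c nu : uniq l -> (forall e, (nu (t e) <= B)%N) ->
  transfers w l c nu =
  \sum_(a | supp_in l a) if admissible nu a then weight w a * c (moved nu a) else 0.
Proof.
elim: l nu => [|e l IHl] nu /=.
  move=> _ _; rewrite (big_pred1 [ffun=> ord0]); last first.
    move=> a; apply/forallP/eqP => [h|-> e]; last by rewrite ffunE.
    by apply/ffunP => e; rewrite ffunE; apply/eqP; exact: h.
  have f0 (f : E -> V) v : (\sum_(e | f e == v) [ffun=> ord0 : 'I_B.+1] e = 0)%N.
    by apply: big1 => e _; rewrite ffunE.
  have -> : admissible nu [ffun=> ord0].
    by apply/forallP => v; rewrite /inflow f0.
  rewrite /weight big1 ?mul1r => [|e _]; last by rewrite ffunE.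
  by congr c; apply: funext => v; rewrite /moved /inflow /outflow !f0 addn0 subn0.
move=> /andP[el ul] nuB; rewrite sum_supp_cons // /transfer.
rewrite (big_ord_widen B.+1 (fun b => w e ^+ b *
  transfers w l c (fun v => nu v + b * (v == s e) - b * (v == t e))%N)) ?ltnS //.
rewrite big_mkcond; apply: eq_bigr => b _.
have ae0 a : supp_in l a -> a e = ord0.
  by move=> /forallP /(_ e); rewrite (negPf el) => /eqP.
case: ifP => bnu; last first.
  rewrite big1 // => a /ae0 ae; rewrite ifF //; apply/negP => /forallP /(_ (t e)).
  by rewrite /inflow flow_upd // eqxx muln1; lia.
rewrite IHl // => [|e']; last first.
  by rewrite eq_sym (negPf (st _ _)) muln0 addn0 (leq_trans (leq_subr _ _)).
rewrite mulr_sumr; apply: eq_bigr => a sa; have ae := ae0 _ sa.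
have -> : admissible nu (upd a e b) =
    admissible (fun v => nu v + b * (v == s e) - b * (v == t e))%N a.
  apply: eq_forallb => v; rewrite /inflow flow_upd // -/(inflow a v).
  have [->|vs] := eqVneq v (s e).
    by rewrite inflow_source (negPf (st _ _)) muln0.
  by have [->|vt] := eqVneq v (t e); lia.
case: ifP => _; last by rewrite mulr0.
rewrite weight_upd // mulrA; congr (_ * c _); apply: funext => v.
rewrite /moved /inflow /outflow !flow_upd // -/(inflow a v) -/(outflow a v).
have [->|vs] := eqVneq v (s e).
  by rewrite inflow_source (negPf (st _ _)) muln0; lia.
have [->|vt] := eqVneq v (t e); last by lia.
by rewrite outflow_target; lia.
Qed.

Lemma transfersE w c nu : (forall e, (nu (t e) <= B)%N) ->
  transfers w (enum E) c nu = \sum_(a | admissible nu a) weight w a * c (moved nu a).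
Proof.
move=> nuB; rewrite transfers_supp ?enum_uniq // -big_mkcondr.
by apply: eq_bigl => a; rewrite andb_idl // => _; apply/forallP => e; rewrite mem_enum.
Qed.

Lemma lorentzian_transfers w l c : (forall e, 0 < w e) -> lorentzian c ->
  lorentzian (transfers w l c).
Proof.
move=> w0 cL; elim: l => //= e l IHl; exact: lorentzian_transfer.
Qed.

Definition table_sum w (T nu : V -> nat) : R :=
  \sum_(a | admissible nu a && [forall v, moved nu a v == T v]) weight w a.

(** The truncated differences add up to the distance. By convexity of the square, [x ^+ sqdist m n]
    is log-concave in [m] for [0 < x <= 1]; at [x = 0] it is the indicator of [m = n]. *)
Definition sqdist (m n : nat) : nat := ((m - n) + (n - m)) ^ 2.

(* Perturbing the weights and the point mass at [T] makes everything positive;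
   the perturbed sums are polynomials in the perturbation parameter. *)
Definition table_poly w (T nu : V -> nat) : {poly R} :=
  \sum_(a | admissible nu a)
    (\prod_e ((w e)%:P + 'X) ^+ a e) * \prod_v 'X^(sqdist (moved nu a v) (T v)).

Lemma table_poly_at0 w T nu : (table_poly w T nu).[0] = table_sum w T nu.
Proof.
rewrite /table_poly horner_sum /table_sum [RHS]big_mkcondr; apply: eq_bigr => a _ /=.
rewrite hornerM !horner_prod.
under eq_bigr => e _ do rewrite horner_exp hornerD hornerC hornerX addr0.
under [X in _ * X]eq_bigr => v _ do rewrite hornerXn.
case: ifP => [/forallP h|/forallP h].
  by rewrite [X in _ * X]big1 ?mulr1 // => v _; rewrite (eqP (h v)) /sqdist subnn.
have /existsP[v hv] : [exists v, moved nu a v != T v].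
  by rewrite -negb_forall; apply/negP => /forallP.
have d0 : (sqdist (moved nu a v) (T v) == 0)%N = false.
  by apply/negP; rewrite /sqdist expn_eq0; lia.
by rewrite [X in _ * X](bigD1 v) //= expr0n d0 mul0r mulr0.
Qed.

Lemma table_poly_transfers w T nu (x : R) : (forall e, (nu (t e) <= B)%N) ->
  (table_poly w T nu).[x] =
  transfers (fun e => w e + x) (enum E) (fun mu => \prod_v x ^+ sqdist (mu v) (T v)) nu.
Proof.
move=> nuB; rewrite transfersE // horner_sum; apply: eq_bigr => a _.
rewrite hornerM !horner_prod; congr (_ * _); apply: eq_bigr => e _.
  by rewrite horner_exp hornerD hornerC hornerX.
by rewrite hornerXn.
Qed.

(** For a perturbation [r] between 0 and 1 the sum arises by transfers from a Lorentzian product, so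
    it is log-concave between [x] and [y]; being polynomial in [r], the inequality passes to
    [r = 0]. *)
Lemma table_sum_slc w T nu (x y : V) M : (forall e, 0 <= w e) -> x != y ->
  (forall m e, (m <= M)%N ->
    (nu (t e) + m * (t e == x) + (M - m) * (t e == y) <= B)%N) ->
  slc (fun m => table_sum w T (fun v => nu v + m * (v == x) + (M - m) * (v == y))%N) M.
Proof.
move=> w0 xy nuB i j ij jM; rewrite -!table_poly_at0 -!hornerM -subr_ge0 -hornerN -hornerD.
apply: horner0_ge0 => r r0 r1; rewrite hornerD hornerN !hornerM subr_ge0.
rewrite !table_poly_transfers; try by move=> e; apply: nuB; lia.
pose c := transfers (fun e => w e + r) (enum E) (fun mu => \prod_v r ^+ sqdist (mu v) (T v)).
suff cL : lorentzian c by exact: (lorentzian_slc nu cL xy ij jM).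
apply: lorentzian_transfers => [e|]; first by rewrite ltr_wpDl.
apply: (lorentzian_prod (u := fun v m => r ^+ sqdist m (T v))) => [v m|v m].
  by rewrite exprn_gt0.
rewrite -exprD -exprM; apply: ler_wiXn2l; [exact: ltW|exact: ltW|].
rewrite /sqdist; have [] := leqP (T v) m; nia.
Qed.

End Tables.

(** * Freeing one variable *)

Section OneVariable.
Variable R : realType.
Implicit Types (c : nat -> R) (r t x : R).

Lemma expR_hfun_nat n :
  expR (hfun (n%:R : R)) = (n.+1%:R) ^+ n.+1 / n%:R ^+ n.
Proof.
rewrite /hfun natr1 expRD expRN !expRM_natl lnK ?posrE ?ltr0n //.
by case: n => [|n]; rewrite ?expr0 // lnK ?posrE ?ltr0n.
Qed.

Lemma hfun0 : hfun (0 : R) = 0.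
Proof. by rewrite /hfun add0r ln1 mulr0 mul0r subr0. Qed.

Lemma geometric_le x n : 0 <= x -> x < 1 -> \sum_(m < n) x ^+ m <= (1 - x)^-1.
Proof.
move=> x0 x1; have h : 0 < 1 - x by rewrite subr_gt0.
rewrite -[leRHS]mul1r ler_pdivlMr // mulrC.
have -> : (1 - x) * \sum_(i < n) x ^+ i = 1 - x ^+ n.
  by rewrite -opprB mulNr -subrX1 opprB.
by rewrite gerBl exprn_ge0.
Qed.

(* [t = theta / r] with [theta = b / (b + 1)], the mean-[b] geometric law. *)
Lemma geometric_bound c r C b M : (0 < b)%N -> 0 < r -> 0 <= C ->
  (forall m, (m <= M)%N -> c m * r ^+ b <= C * r ^+ m) ->
  \sum_(m < M.+1) c m * (b%:R / b.+1%:R / r) ^+ m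
    <= expR (hfun b%:R) * (b%:R / b.+1%:R / r) ^+ b * C.
Proof.
move=> b0 r0 C0 hc; set th := b%:R / b.+1%:R.
have th0 : 0 < th by rewrite divr_gt0 ?ltr0n.
have th1 : 1 - th = b.+1%:R^-1.
  by rewrite /th -natr1; field; rewrite natr1 pnatr_eq0.
have rb : 0 < r ^+ b by rewrite exprn_gt0.
(* At [th = b / (b + 1)] one has [e^(h b) th^b = b + 1 = 1 / (1 - th)]. *)
have -> : expR (hfun b%:R) * (th / r) ^+ b * C = C / r ^+ b * (1 - th)^-1.
  rewrite expR_hfun_nat th1 invrK expr_div_n /th expr_div_n exprS.
  by field; rewrite !expf_neq0 ?pnatr_eq0 -?lt0n ?gt_eqF.
have := geometric_le M.+1 (ltW th0); rewrite -subr_gt0 th1 invr_gt0 ltr0n => /(_ isT) g.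
apply: le_trans (ler_wpM2l (divr_ge0 C0 (ltW rb)) g).
rewrite mulr_sumr; apply: ler_sum => m _.
have := hc m (ltn_ord m) => h.
rewrite expr_div_n mulrCA [leRHS]mulrC ler_pM2l ?exprn_gt0 //.
by rewrite ler_pdivrMr ?exprn_gt0 // mulrAC ler_pdivlMr.
Qed.

(** Successive ratios of [c] are at least [r] before [b] and at most [r] after it, so the geometric
    sequence of ratio [r] through [c b] dominates [c]. *)
Lemma slc_ratio c M b m : (forall m, (m <= M)%N -> 0 <= c m) -> slc c M ->
  (b < M)%N -> 0 < c b -> 0 < c b.+1 -> (m <= M)%N ->
  c m * (c b.+1 / c b) ^+ b <= c b * (c b.+1 / c b) ^+ m.
Proof.
move=> c0 lc bM cb cb1; set r := c b.+1 / c b.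
have r0 : 0 < r by rewrite divr_gt0.
have rE : r * c b = c b.+1 by rewrite /r divfK ?gt_eqF.
have up k : (b + k <= M)%N -> c (b + k)%N <= c b * r ^+ k.
  elim: k => [|k IHk] bk; first by rewrite addn0 expr0 mulr1.
  have h : c (b + k).+1 <= r * c (b + k)%N.
    by rewrite -(ler_pM2l cb) mulrCA mulrA rE lc //; lia.
  rewrite addnS exprS mulrCA; apply: (le_trans h).
  by rewrite ler_pM2l // IHk; lia.
have down k : (k <= b)%N -> c (b - k)%N * r ^+ k <= c b.
  elim: k => [|k IHk] bk; first by rewrite subn0 expr0 mulr1.
  have bk1 : (b - k = (b - k.+1).+1)%N by lia.
  have h : c (b - k.+1)%N * r <= c (b - k)%N.
    rewrite -(ler_pM2r cb) -mulrA rE bk1 lc //; lia.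
  rewrite exprS mulrA; apply: le_trans (IHk _); last by lia.
  by rewrite ler_pM2r ?exprn_gt0.
move=> mM; case: (leqP b m) => bm.
  have -> : r ^+ m = r ^+ (m - b) * r ^+ b by rewrite -exprD subnK.
  by rewrite mulrA ler_pM2r ?exprn_gt0 // -{1}(subnKC bm) up ?subnKC.
have -> : r ^+ b = r ^+ (b - m) * r ^+ m by rewrite -exprD subnK // ltnW.
by rewrite mulrA ler_pM2r ?exprn_gt0 // -{1}(subKn (ltnW bm)) down ?leq_subr.
Qed.

Lemma slc_gt0_between c M i j k : (forall m, (m <= M)%N -> 0 <= c m) -> slc c M ->
  (j <= M)%N -> 0 < c i -> 0 < c j -> (i <= k <= j)%N -> 0 < c k.
Proof.
move=> c0 lc jM ci cj /andP[ik kj].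
have ge0 n : 0 <= c (j - n)%N by rewrite c0 // (leq_trans (leq_subr _ _)).
have pos n : (n <= j - i)%N -> 0 < c (j - n)%N.
  elim: n => [|n IHn] nij; first by rewrite subn0.
  have e : (j - n)%N = (j - n.+1).+1 by move: nij; clear; lia.
  have h : c i * c (j - n)%N <= c i.+1 * c (j - n.+1)%N.
    by rewrite e; apply: lc; move: nij jM; clear; lia.
  have p : 0 < c i * c (j - n)%N by rewrite mulr_gt0 // IHn // ltnW.
  rewrite lt_def ge0 andbT; apply/eqP => z; move: h.
  by rewrite z mulr0 leNgt p.
by rewrite -(subKn kj) pos // leq_sub2l.
Qed.

(** If [c] has positive terms on both sides of [b], the ratio [c b.+1 / c b] feeds
    [geometric_bound]. Otherwise the best [t] may lie at 0 or at infinity, and the slack [d] permits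
    a finite positive one. *)
Lemma one_variable c M b d : (forall m, (m <= M)%N -> 0 <= c m) -> slc c M ->
  (b <= M)%N -> 0 < d ->
  exists2 t, 0 < t &
    \sum_(m < M.+1) c m * t ^+ m <= expR (hfun b%:R) * t ^+ b * (c b + d).
Proof.
move=> c0 lc bM d0; pose S := \sum_(m < M.+1) c m.
have S0 : 0 <= S by apply: sumr_ge0 => i _; rewrite c0 // -ltnS.
have cS m : (m <= M)%N -> c m <= S.
  move=> mM; rewrite /S (bigD1 (Ordinal (mM : (m < M.+1)%N))) //= lerDl.
  by apply: sumr_ge0 => i _; rewrite c0 // -ltnS.
have cb0 := c0 _ bM.
have [b0|b0] := posnP b.
  (* Chosen so that [S * t <= d], which covers all terms after the constant one. *)
  subst b; exists (d / (S + d)); first by rewrite divr_gt0 // ltr_wpDl.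
  set t := d / (S + d).
  have Sd : 0 < S + d by rewrite ltr_wpDl.
  have t0 : 0 < t by rewrite divr_gt0.
  have t1 : t <= 1 by rewrite ler_pdivrMr // mul1r lerDr.
  rewrite hfun0 expR0 !mul1r big_ord_recl expr0 mulr1 lerD2l.
  apply: (@le_trans _ _ (S * t)); last first.
    by rewrite /t mulrCA ger_pMr // ler_pdivrMr // mul1r lerDl ltW.
  rewrite /S mulr_suml big_ord_recl -[leLHS]add0r lerD //.
    by rewrite mulr_ge0 ?c0 // ltW.
  apply: ler_sum => i _; apply: ler_wpM2l; first by rewrite c0 // -ltnS ltn_ord.
  by rewrite lift0 exprS ger_pMr // exprn_ile1 // ltW.
pose C := c b + d.
have C0 : 0 < C by rewrite ltr_wpDl.
suff [r r0 hr] : exists2 r, 0 < r & forall m, (m <= M)%N -> c m * r ^+ b <= C * r ^+ m.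
  exists (b%:R / b.+1%:R / r); first by rewrite !divr_gt0 ?ltr0n.
  exact: geometric_bound (ltW C0) hr.
have SC : 0 < S + C by rewrite ltr_wpDl.
have [up|] := pselect (forall m, (b < m <= M)%N -> c m = 0).
  (* Chosen so that [S * r <= C], which covers the terms before [b]. *)
  exists (C / (S + C)); first by rewrite divr_gt0.
  set r := C / (S + C) => m mM.
  have r0 : 0 < r by rewrite divr_gt0.
  have r1 : r <= 1 by rewrite ler_pdivrMr // mul1r lerDr.
  case: (leqP m b) => bm; last by rewrite up ?bm // mul0r mulr_ge0 ?exprn_ge0 // ltW.
  have -> : r ^+ b = r ^+ (b - m) * r ^+ m by rewrite -exprD subnK.
  rewrite mulrA ler_pM2r ?exprn_gt0 //.
  move: bm; rewrite leq_eqVlt => /orP[/eqP ->|bm].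
    by rewrite subnn expr0 mulr1 lerDl ltW.
  have -> : (b - m = (b - m).-1.+1)%N by lia.
  apply: (@le_trans _ _ (S * r)).
    apply: ler_pM; rewrite ?c0 ?cS ?exprn_ge0 ?(ltW r0) //.
    by rewrite exprS ger_pMr // exprn_ile1 // ltW.
  by rewrite /r mulrCA ger_pMr // ler_pdivrMr // mul1r lerDl ltW.
move=> /existsNP[j /not_implyP[/andP[bj jM] /eqP cj]].
have [dn|] := pselect (forall m, (m < b)%N -> c m = 0).
  (* Chosen so that [C * r >= S], which covers the terms after [b]. *)
  exists ((S + C) / C); first by rewrite divr_gt0.
  set r := (S + C) / C => m mM.
  have r0 : 0 < r by rewrite divr_gt0.
  have r1 : 1 <= r by rewrite ler_pdivlMr // mul1r lerDr.
  case: (leqP b m) => bm; last by rewrite dn // mul0r mulr_ge0 ?exprn_ge0 // ltW.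
  have -> : r ^+ m = r ^+ (m - b) * r ^+ b by rewrite -exprD subnK.
  rewrite mulrA ler_pM2r ?exprn_gt0 //.
  move: bm; rewrite leq_eqVlt => /orP[/eqP <-|bm].
    by rewrite subnn expr0 mulr1 lerDl ltW.
  have -> : (m - b = (m - b).-1.+1)%N by lia.
  apply: (@le_trans _ _ (C * r)).
    by rewrite /r mulrC divfK ?gt_eqF // (le_trans (cS _ mM)) // lerDl ltW.
  by rewrite ler_pM2l // exprS ler_pMr // exprn_ege1.
move=> /existsNP[i /not_implyP[ib /eqP ci]].
have pos k : (i <= k <= j)%N -> 0 < c k.
  have iM : (i <= M)%N by rewrite (leq_trans (ltnW ib)).
  by apply: (slc_gt0_between c0 lc jM); rewrite lt_def ?ci ?cj c0.
have cb : 0 < c b by rewrite pos // (ltnW ib) (ltnW bj).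
have cb1 : 0 < c b.+1 by rewrite pos // bj (leqW (ltnW ib)).
exists (c b.+1 / c b); first by rewrite divr_gt0.
move=> m mM; apply: (le_trans (slc_ratio c0 lc (leq_trans bj jM) cb cb1 mM)).
by rewrite ler_wpM2r ?exprn_ge0 ?divr_ge0 ?lerDl // ltW.
Qed.

End OneVariable.

(** * The row bound *)

Section RowBound.
Import numFieldNormedType.Exports.
Variable R : realType.
Implicit Types (f t x : R) (l : seq R).

(* [t^-f / (1 - t)] is minimised at [t = f / (f + 1)], with value [e^(h f)]. *)
Lemma entry_dual f t : 0 <= f -> 0 <= t -> t < 1 -> (t = 0 -> f = 0) ->
  expR (hfun f + f * ln t) <= (1 - t)^-1.
Proof.
move=> f0 t0 t1 tf; have t10 : 0 < 1 - t by rewrite subr_gt0.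
rewrite -[leRHS]lnK ?posrE ?invr_gt0 // ler_expR lnV ?posrE //.
have lnle (u : R) : 0 < u -> ln u <= u - 1.
  move=> u0; have h := @le_ln1Dx R (u - 1).
  by rewrite -{1}(subrK 1 u) addrC; apply: h; lra.
have f1 : 0 < f + 1 by rewrite ltr_wpDl.
(* The inequality [ln u <= u - 1] is used here and, with weight [f], at [t * (f + 1) / f]; the two
   right-hand sides add up to zero. *)
have h2 : ln ((1 - t) * (f + 1)) <= (1 - t) * (f + 1) - 1 by rewrite lnle // mulr_gt0.
rewrite lnM ?posrE // in h2.
have [f00|fn0] := eqVneq f 0.
  by rewrite /hfun f00 !mul0r !add0r !subr0 addr0 ln1 mulr0 oppr_ge0; apply: ln_le0; lra.
have fp : 0 < f by rewrite lt_def fn0.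
have tp : 0 < t by rewrite lt_def t0 andbT; apply: contra_neq fn0.
have h1 : f * ln (t * (f + 1) / f) <= f * (t * (f + 1) / f - 1).
  by rewrite ler_pM2l // lnle // divr_gt0 // mulr_gt0.
rewrite ln_div ?posrE ?mulr_gt0 // lnM ?posrE // in h1.
have e : f * (t * (f + 1) / f - 1) = t * (f + 1) - f by field.
rewrite e in h1; rewrite /hfun; lra.
Qed.

(** The complete homogeneous symmetric polynomial of degree [k] in the entries of [l]. *)
Fixpoint complete_hom l (k : nat) : R :=
  if l is z :: l' then \sum_(b < k.+1) z ^+ b * complete_hom l' (k - b) else (k == 0%N)%:R.

Lemma complete_hom_cons0 z l : complete_hom (z :: l) 0 = complete_hom l 0.
Proof. by rewrite /= big_ord1 expr0 mul1r. Qed.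

Lemma complete_hom_consS z l k : complete_hom (z :: l) k.+1 =
  complete_hom l k.+1 + z * complete_hom (z :: l) k.
Proof.
rewrite /= big_ord_recl /= expr0 mul1r; congr (_ + _).
by rewrite mulr_sumr; apply: eq_bigr => b _; rewrite /bump add1n subSS exprS mulrA.
Qed.

Lemma complete_hom_ge0 l k : all (>= 0) l -> 0 <= complete_hom l k.
Proof.
elim: l k => [|z l IHl] k /=; first by rewrite ler0n.
move=> /andP[z0 l0]; apply: sumr_ge0 => b _.
by rewrite mulr_ge0 ?exprn_ge0 ?IHl.
Qed.

Lemma complete_hom_gt0 l k : all (>= 0) l -> has (> 0) l -> 0 < complete_hom l k.
Proof.
elim: l k => [|z l IHl] k //= /andP[z0 l0] /orP[zp|hl].
  have c0 : 0 < complete_hom l 0 .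
    by elim: {+}l {IHl} l0 => [|u m IHm] /=; rewrite ?eqxx ?ltr01 //
      => /andP[_ /IHm]; rewrite big_ord1 expr0 mul1r.
  rewrite big_ord_recr /= subnn; apply: ltr_wpDl; last by rewrite mulr_gt0 ?exprn_gt0.
  by apply: sumr_ge0 => b _; rewrite mulr_ge0 ?exprn_ge0 ?complete_hom_ge0.
rewrite big_ord_recl /=; apply: ltr_pwDl; first by rewrite expr0 mul1r IHl.
by apply: sumr_ge0 => b _; rewrite mulr_ge0 ?exprn_ge0 ?complete_hom_ge0.
Qed.

(** Removing [z] from the list multiplies the generating function by [1 - x * z]. Both functions are
    positive, which forces [x * z < 1], and induction gives the product. *)
Lemma complete_hom_genfun l x D : 0 <= x -> all (>= 0) l ->
  (forall K, \sum_(k < K) x ^+ k * complete_hom l k <= D) ->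
  all (fun z => x * z < 1) l /\ \prod_(z <- l) (1 - x * z)^-1 <= D.
Proof.
move=> x0; elim: l D => [|z l IHl] D /=.
  by move=> _ /(_ 1%N); rewrite big_ord1 eqxx expr0 mul1r big_nil.
move=> /andP[z0 l0] hD; have zl0 : all (>= 0) (z :: l) by rewrite /= z0.
pose P' K := \sum_(k < K) x ^+ k * complete_hom (z :: l) k.
pose P K := \sum_(k < K) x ^+ k * complete_hom l k.
have ndP' : nondecreasing_seq P'.
  apply/nondecreasing_seqP => n; rewrite /P' big_ord_recr lerDl.
  by apply: mulr_ge0; [exact: exprn_ge0|exact: complete_hom_ge0].
have ndP : nondecreasing_seq P.
  apply/nondecreasing_seqP => n; rewrite /P big_ord_recr /= lerDl.
  by apply: mulr_ge0; [exact: exprn_ge0|exact: complete_hom_ge0].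
have cP' : cvgn P'.
  apply: nondecreasing_is_cvgn => //; exists D => _ [K _ <-]; exact: hD.
pose p : R := limn P'.
have pD : p <= D by apply: limr_le => //; apply: nearW => K; exact: hD.
(* The product with [1 - x * z], at the level of partial sums. *)
have rec K : P K.+1 = P' K.+1 - x * z * P' K.
  rewrite /P /P' !big_ord_recl complete_hom_cons0 -addrA; congr (_ + _).
  rewrite mulr_sumr -sumrB; apply: eq_bigr => k _.
  by rewrite !lift0 complete_hom_consS exprS; ring.
pose q : R := p * (1 - x * z).
have cP : P K @[K --> \oo] --> q.
  rewrite -(cvg_shiftS P) /= (_ : (fun K => P K.+1) = (fun K => P' K.+1 - x * z * P' K));
    last exact: funext.
  have -> : q = p - x * z * p by rewrite /q; ring.
  apply: cvgB; first by rewrite (cvg_shiftS P'); exact: cP'.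
  by apply: cvgMr; exact: cP'.
have PK K : P K <= p * (1 - x * z).
  rewrite -/q -(cvg_lim _ cP) //; apply: nondecreasing_cvgn_le => //.
  by apply/cvg_ex; exists q.
have [lt1 prod1] := IHl _ l0 PK.
have P1 : 0 < P 1%N.
  rewrite /P big_ord1 expr0 mul1r.
  by elim: {+}l {IHl lt1 prod1} l0 => [|u m IHm] /=; rewrite ?eqxx ?ltr01 //
    => /andP[_ /IHm]; rewrite big_ord1 expr0 mul1r.
have p0 : 0 < p.
  apply: lt_le_trans (nondecreasing_cvgn_le ndP' cP' 1%N).
  by rewrite /P' big_ord1 complete_hom_cons0; move: P1; rewrite /P big_ord1.
have xz : x * z < 1.
  rewrite -subr_gt0 -(pmulr_rgt0 _ p0); exact: lt_le_trans (PK 1%N).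
split; first by rewrite xz.
rewrite big_cons; apply: le_trans pD.
by rewrite mulrC ler_pdivrMr // subr_gt0.
Qed.

End RowBound.

(** * The row bound as a sum over one row of a table *)

Section RowBoundTables.
Variables (R : realType) (J : finType).
Implicit Types (z f : J -> R).

Definition hom_sum B z (k : nat) : R :=
  \sum_(a : {ffun J -> 'I_B.+1} | (\sum_j a j == k)%N) weight z a.

Lemma total_upd B (a : {ffun J -> 'I_B.+1}) e b : a e = ord0 ->
  (\sum_j upd a e b j = \sum_j a j + b)%N.
Proof.
by move=> ae; rewrite -[X in (_ + X)%N]muln1; exact: (flow_upd (fun=> tt) b tt ae).
Qed.

Lemma complete_hom_supp B z l k : uniq l -> (k <= B)%N ->
  \sum_(a : {ffun J -> 'I_B.+1} | supp_in l a)
     (if (\sum_j a j == k)%N then weight z a else 0) = complete_hom (map z l) k.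
Proof.
elim: l k => [|e l IHl] k /=.
  move=> _ _; rewrite (big_pred1 [ffun=> ord0]); last first.
    move=> a; apply/forallP/eqP => [h|-> e]; last by rewrite ffunE.
    by apply/ffunP => e; rewrite ffunE; apply/eqP; exact: h.
  rewrite big1 => [|j _]; last by rewrite ffunE.
  rewrite eq_sym; case: eqP => //= _.
  by rewrite /weight big1 // => j _; rewrite ffunE.
move=> /andP[el ul] kB; rewrite sum_supp_cons //.
rewrite (big_ord_widen B.+1 (fun b => z e ^+ b * complete_hom (map z l) (k - b))) ?ltnS //.
rewrite [RHS]big_mkcond; apply: eq_bigr => b _.
have ae0 (a : {ffun J -> 'I_B.+1}) : supp_in l a -> a e = ord0.
  by move=> /forallP /(_ e); rewrite (negPf el) => /eqP.
case: ifP => bk; last first.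
  rewrite big1 // => a /ae0 ae; rewrite total_upd // ifF //; lia.
rewrite -(IHl (k - b)%N) // ?(leq_trans (leq_subr _ _)) // mulr_sumr.
apply: eq_bigr => a /ae0 ae; rewrite total_upd // weight_upd //.
have -> : (\sum_j a j + b == k)%N = (\sum_j a j == k - b)%N by lia.
by case: ifP => _ //; rewrite mulr0.
Qed.

Lemma hom_sumE B z k : (k <= B)%N -> hom_sum B z k = complete_hom (map z (enum J)) k.
Proof.
move=> kB; rewrite -(complete_hom_supp _ (enum_uniq J) kB) -big_mkcondr.
by apply: eq_bigl => a; rewrite andb_idl // => _; apply/forallP => e; rewrite mem_enum.
Qed.

(** The case of two vertices: every cell moves units from [false] to [true]. Starting with [m] units
    at [true] and ending with all [M] there moves [M - m] units, hence the reversed index. *)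
Lemma complete_hom_slc z M : (forall j, 0 <= z j) -> slc (complete_hom (map z (enum J))) M.
Proof.
move=> z0.
have key m : (m <= M)%N -> complete_hom (map z (enum J)) (M - m) =
  table_sum (fun=> true) (fun=> false) M z (fun v => if v then M else 0%N)
    (fun v => 0 + m * (v == true) + (M - m) * (v == false))%N.
  move=> mM; rewrite -(@hom_sumE M) ?leq_subr //.
  apply: eq_bigl => a.
  have iT : inflow (fun=> false) a true = 0%N by rewrite /inflow big_pred0.
  have iF : inflow (fun=> false) a false = (\sum_j a j)%N by rewrite /inflow; apply: eq_bigl.
  have oF : outflow (fun=> true) a false = 0%N by rewrite /outflow big_pred0.
  have oT : outflow (fun=> true) a true = (\sum_j a j)%N by rewrite /outflow; apply: eq_bigl.
  apply/idP/idP => [/eqP e|/andP[/forallP adm /forallP mv]].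
    apply/andP; split; apply/forallP => -[]; rewrite /moved ?iT ?iF ?oF ?oT ?e /=; lia.
  by have := mv true; have := adm false; rewrite /moved iT iF oT /=; lia.
move=> i j ij jM.
have := @table_sum_slc R J bool (fun=> true) (fun=> false) M (fun _ _ => isT) z
  (fun v => if v then M else 0%N) (fun=> 0%N) true false M z0 isT.
move=> /(_ _ (M - j.+1)%N (M - i.+1)%N).
have -> : (M - j.+1).+1 = (M - j)%N by lia.
have -> : (M - i.+1).+1 = (M - i)%N by lia.
rewrite -!key ?leq_subr // !subKn //; try by lia.
rewrite mulrC [leRHS]mulrC; apply; try by lia.
Qed.

Lemma weight_ge0 B z (a : {ffun J -> 'I_B.+1}) : (forall j, 0 <= z j) -> 0 <= weight z a.
Proof. by move=> z0; apply: prodr_ge0 => j _; rewrite exprn_ge0. Qed.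

(** Log-concavity of [complete_hom] bounds its generating function at a well-chosen [x] by
    [e^(h k) x^k] times its [k]-th coefficient. The product formula and [entry_dual] at each
    [x * z j] bound it below; the powers of [x] cancel since the [f j] sum to [k]. *)
Lemma row_bound B z f k : (forall j, 0 <= z j) -> (forall j, 0 <= f j) ->
  (forall j, z j = 0 -> f j = 0) -> (k <= B)%N -> \sum_j f j = k%:R ->
  expR (\sum_j (hfun (f j) + f j * ln (z j))) <= expR (hfun (k%:R)) * hom_sum B z k.
Proof.
move=> z0 f0 zf kB fk; rewrite hom_sumE //; set l := map z (enum J).
have l0 : all (>= 0) l by apply/allP => _ /mapP[j _ ->].
case: k => [|k] in kB fk *.
  have fz j : f j = 0.
    by apply/eqP; move/eqP: fk;
      rewrite psumr_eq0 // => /allP /(_ j); rewrite mem_index_enum => /(_ isT).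
  rewrite big1 => [|j _]; last by rewrite fz hfun0 mul0r addr0.
  rewrite hfun0 expR0 mul1r.
  suff -> : complete_hom l 0 = 1 by [].
  by elim: l {l0} => [|y l IHl]; rewrite ?complete_hom_cons0 //= eqxx.
have hl : has (> 0) l.
  have [j fj] : exists j, f j != 0.
    apply/not_existsP => h; move: fk; rewrite big1 => [/eqP|j _].
      by rewrite eq_sym pnatr_eq0.
    by apply/eqP; apply: contrapT => /negP; exact: h.
  apply/hasP; exists (z j); first by apply: map_f; rewrite mem_enum.
  by rewrite lt_def z0 andbT; apply: contra_neq fj => /zf.
have H0 m : 0 < complete_hom l m by apply: complete_hom_gt0.
(* After the case split the margin is [k.+1]; [x] is the point [theta / r] of [geometric_bound]. *)
pose b := k.+1; pose r := complete_hom l b.+1 / complete_hom l b; pose x : R := b%:R / b.+1%:R / r.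
have r0 : 0 < r by rewrite divr_gt0.
have x0 : 0 < x by rewrite !divr_gt0 // ltr0n.
have part K : \sum_(m < K) x ^+ m * complete_hom l m <=
  expR (hfun b%:R) * x ^+ b * complete_hom l b.
  pose M := (K + b.+1)%N.
  apply: (@le_trans _ _ (\sum_(m < M.+1) complete_hom l m * x ^+ m)).
    rewrite (big_ord_widen M.+1 (fun m => x ^+ m * complete_hom l m)); last by rewrite /M; lia.
    rewrite big_mkcond; apply: ler_sum => m _; case: ifP => _; rewrite mulrC //.
    by rewrite mulr_ge0 ?exprn_ge0 // ltW.
  apply: (@geometric_bound R (complete_hom l) r (complete_hom l b) b M) => //; first exact: ltW.
  move=> m mM; apply: (@slc_ratio _ _ M) => //.
  - by move=> m' _; exact: ltW.
  - exact: complete_hom_slc.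
  - by rewrite /M; lia.
have [lt1 prod1] := complete_hom_genfun (ltW x0) l0 part.
rewrite -(ler_pM2r (exprn_gt0 b x0)) -mulrA [complete_hom l b * _]mulrC mulrA.
apply: le_trans prod1; rewrite big_map big_enum /=.
have -> : x ^+ b = expR (\sum_j f j * ln x).
  by rewrite -mulr_suml fk expRM_natl lnK.
rewrite -expRD -big_split expR_sum; apply: ler_prod => j _.
rewrite expR_ge0 /=.
have xz : x * z j < 1.
  by move/allP: lt1; apply; apply: map_f; rewrite mem_enum.
have -> : hfun (f j) + f j * ln (z j) + f j * ln x = hfun (f j) + f j * ln (x * z j).
  have [zj|zj] := eqVneq (z j) 0; first by rewrite zf // !mul0r addr0.
  by rewrite lnM ?posrE // ?lt_def ?zj ?z0 //; ring.
apply: entry_dual => //; first by rewrite mulr_ge0 // ltW.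
by move=> /eqP; rewrite mulf_eq0 gt_eqF //= => /eqP /zf.
Qed.

End RowBoundTables.

(** * The column bound *)

Section ColumnBound.
Variables (R : realType) (I J : finType) (B : nat) (W : I -> J -> R).
Variables (al : I -> nat) (be : J -> nat).
Hypothesis W0 : forall i j, 0 <= W i j.
Hypothesis al_be : (\sum_i al i = \sum_j be j)%N.
Hypothesis al_B : (\sum_i al i <= B)%N.
Local Notation table := {ffun I * J -> 'I_B.+1}.
Implicit Types (a : table) (y : J -> R) (l : seq J).

Definition rowsum a (i : I) : nat := \sum_(e | e.1 == i) a e.
Definition colsum a (j : J) : nat := \sum_(e | e.2 == j) a e.

Lemma rowsumE a i : rowsum a i = (\sum_j a (i, j))%N.
Proof.
pose F i' j : nat := if i' == i then (a (i', j) : nat) else 0%N.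
transitivity (\sum_(e : I * J) F e.1 e.2)%N.
  by rewrite /rowsum big_mkcond; apply: eq_bigr => -[].
rewrite -(pair_bigA addn F) (bigD1 i) //= [X in (_ + X)%N]big1 ?addn0 => [|i' /negPf ne].
  by apply: eq_bigr => j _; rewrite /F eqxx.
by apply: big1 => j _; rewrite /F ne.
Qed.

Lemma colsumE a j : colsum a j = (\sum_i a (i, j))%N.
Proof.
pose F i j' : nat := if j' == j then (a (i, j') : nat) else 0%N.
transitivity (\sum_(e : I * J) F e.1 e.2)%N.
  by rewrite /colsum big_mkcond; apply: eq_bigr => -[].
rewrite -(pair_bigA addn F); apply: eq_bigr => i _.
by rewrite -(big_pred1_eq addn j (fun j => a (i, j) : nat)) [RHS]big_mkcond.
Qed.

Definition wt y (e : I * J) : R := W e.1 e.2 * y e.2.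

Definition rows_ok a := [forall i, rowsum a i == al i].

(* Tables with row sums [al] whose columns outside [l] have sums [g]; the
   columns in [l] are free and weighted by [y]. *)
Definition part_sum l y (g : J -> nat) : R :=
  \sum_(a | rows_ok a && [forall j, (j \in l) || (colsum a j == g j)]) weight (wt y) a.

Lemma wt_ge0 y e : (forall j, 0 <= y j) -> 0 <= wt y e.
Proof. by move=> y0; rewrite mulr_ge0. Qed.

Lemma part_sum_ge0 l y g : (forall j, 0 <= y j) -> 0 <= part_sum l y g.
Proof.
by move=> y0; apply: sumr_ge0 => a _; apply: weight_ge0 => e; exact: wt_ge0.
Qed.

Lemma sum_rowsum a : (\sum_i rowsum a i = \sum_e a e)%N.
Proof. by rewrite (partition_big (fun e : I * J => e.1) xpredT). Qed.

Lemma sum_colsum l a : (\sum_(j in l) colsum a j = \sum_(e | e.2 \in l) a e)%N.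
Proof.
rewrite [RHS](partition_big (fun e : I * J => e.2) (mem l)) //=.
apply: eq_bigr => j jl; apply: eq_bigl => e.
by case: eqP => [->|]; rewrite ?jl ?andbF.
Qed.

Lemma sum_free_columns l a : rows_ok a ->
  (\sum_(j in l) colsum a j + \sum_(j | j \notin l) colsum a j = \sum_j be j)%N.
Proof.
move=> /forallP ra; rewrite -al_be.
transitivity (\sum_j colsum a j)%N; first by rewrite [RHS](bigID (mem l)).
have -> : (\sum_j colsum a j = \sum_e a e)%N.
  by rewrite (partition_big (fun e : I * J => e.2) xpredT).
by rewrite -sum_rowsum; apply: eq_bigr => i _; exact/eqP.
Qed.

Definition set_at (g : J -> nat) (j0 : J) (m : nat) : J -> nat :=
  fun j => if j == j0 then m else g j.

Lemma sum_fixed_columns l (j0 : J) : j0 \notin l ->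
  (\sum_j be j = \sum_(j in l) be j + (be j0 + \sum_(j | (j \notin l) && (j != j0)) be j))%N.
Proof. by move=> jl; rewrite (bigID (mem l)) /= [X in (_ + X)%N](bigD1 j0). Qed.

(** An instance of [table_sum_slc]: rows are sources, each column outside [l] is its own target, and
    all columns in [l] share the target [None]. Column [j0] starts with [m] units and [None] with
    the remaining [M - m]. *)
Lemma part_sum_slc l y j0 : (forall j, 0 <= y j) -> j0 \notin l ->
  slc (fun m => part_sum l y (set_at be j0 m)) (\sum_(j in l) be j + be j0).
Proof.
move=> y0 jl; set M := (_ + _)%N.
have tot := sum_fixed_columns jl.
set K := (\sum_(j | (j \notin l) && (j != j0)) be j)%N in tot.
pose s (e : I * J) : I + option J := inl e.1.
pose t (e : I * J) : I + option J := inr (if e.2 \in l then None else Some e.2).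
pose T (v : I + option J) := if v is inl i then al i else 0%N.
pose nu (v : I + option J) : nat :=
  if v is inr (Some j) then (if (j \in l) || (j == j0) then 0%N else be j) else 0%N.
pose x : I + option J := inr (Some j0).
pose o : I + option J := inr None.
have key m : (m <= M)%N -> part_sum l y (set_at be j0 m) =
    table_sum s t B (wt y) T (fun v => nu v + m * (v == x) + (M - m) * (v == o))%N.
  move=> mM; apply: eq_bigl => a.
  have inl0 i : inflow t a (inl i) = 0%N by rewrite /inflow big_pred0.
  have inS j : inflow t a (inr (Some j)) = if j \in l then 0%N else colsum a j.
    rewrite /inflow; case: ifP => jl'.
      rewrite big_pred0 // => e; rewrite /t; apply/negP => /eqP [].
      by case: ifP => // el [ej]; move: el; rewrite ej jl'.
    apply: eq_bigl => e; rewrite /t; apply/eqP/eqP => [[]|ej].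
      by case: ifP => // _ [].
    by rewrite ej jl'.
  have inN : inflow t a (inr None) = (\sum_(j in l) colsum a j)%N.
    rewrite sum_colsum; apply: eq_bigl => e; rewrite /t.
    by case: ifP => // _; apply/eqP => -[].
  have outl i : outflow s a (inl i) = rowsum a i by [].
  have outr k : outflow s a (inr k) = 0%N by rewrite /outflow big_pred0.
  have xo : (inr None == x) = false by [].
  have oo : (inr None == o) = true by [].
  have xS j : (inr (Some j) == x) = (j == j0) by apply/eqP/eqP => [[]|->].
  have oS j : (inr (Some j) == o) = false by [].
  have xl i : (inl i == x) = false by [].
  have ol i : (inl i == o) = false by [].
  apply/andP/andP => [[ra /forallP ca]|[/forallP adm /forallP mv]].
    have colN : (\sum_(j in l) colsum a j = M - m)%N.
      have := sum_free_columns l ra; rewrite tot.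
      rewrite [X in (_ + X)%N](bigD1 j0) //=.
      have -> : colsum a j0 = m.
        by have := ca j0; rewrite (negPf jl) /set_at eqxx => /eqP.
      rewrite [X in (_ + (_ + X))%N](eq_bigr be) => [|j /andP[jl' jj0]]; last first.
        by have := ca j; rewrite (negPf jl') /set_at (negPf jj0) => /eqP.
      by rewrite -/K /M => h; apply/eqP; rewrite -(eqn_add2r (m + K)) h !addnA subnK.
    have colS j : j \notin l -> colsum a j = set_at be j0 m j.
      by move=> jl'; have := ca j; rewrite (negPf jl') => /eqP.
    split; apply/forallP => -[i|[j|]].
    - by rewrite inl0.
    - rewrite inS /nu xS oS; case: ifP => //= jl'.
      by rewrite colS ?jl' // /set_at;
        case: (eqVneq j j0) => _ /=; rewrite !(muln0, muln1, addn0, add0n).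
    - by rewrite inN colN /nu xo oo /=; lia.
    - rewrite /moved outl inl0 xl ol /= !muln0 !addn0 subn0 add0n.
      by move/forallP: ra; apply.
    - rewrite /moved outr inS /nu xS oS; have [jl'|jl'] /= := boolP (j \in l).
        have -> : (j == j0) = false by apply/negP => /eqP jj; move: jl; rewrite -jj jl'.
        by rewrite !muln0.
      by rewrite colS // /set_at;
        case: (eqVneq j j0) => _ /=; rewrite !(muln0, muln1, addn0, add0n) subnn.
    - by rewrite /moved outr inN colN /nu xo oo /=; lia.
  split.
    apply/forallP => i; have := mv (inl i).
    by rewrite /moved outl inl0 xl ol /= !muln0 !addn0 subn0 add0n.
  apply/forallP => j; have [jl'|jl'] := boolP (j \in l); first by [].
  have := mv (inr (Some j)); have := adm (inr (Some j)).
  rewrite /moved outr inS (negPf jl') /nu xS oS (negPf jl') /= /set_at.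
  by case: (eqVneq j j0) => _ /=; lia.
move=> i j ij jM; rewrite !key; try lia.
apply: (@table_sum_slc R _ _ s t B _ (wt y) T nu x o M) => //.
- by move=> e; exact: wt_ge0.
- move=> m e mM; have MB : (M + K <= B)%N by rewrite /M; lia.
  have MB' : (M <= B)%N := leq_trans (leq_addr K M) MB.
  rewrite /t; case: ifP => el.
    have -> : (inr None == x) = false by [].
    by rewrite /o eqxx muln0 muln1 !add0n (leq_trans (leq_subr _ _)).
  have -> : (inr (Some e.2) == x) = (e.2 == j0) by apply/eqP/eqP => [[]|->].
  have -> : (inr (Some e.2) == o) = false by [].
  rewrite /nu el /=; case: eqP => [_|/eqP ej]; rewrite ?(muln0, muln1) !addn0.
    exact: leq_trans mM MB'.
  apply: leq_trans (leq_trans (leq_addl M K) MB).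
  by rewrite /K (bigD1 e.2) /= ?el ?ej // leq_addr.
Qed.

Lemma weight_wt_at y j0 (r : R) a :
  weight (wt (fun j => if j == j0 then r * y j else y j)) a = r ^+ colsum a j0 * weight (wt y) a.
Proof.
rewrite /weight /colsum -prodrXr [X in _ = X * _]big_mkcond /= -big_split; apply: eq_bigr => e _ /=.
by rewrite /wt; case: eqP => _; rewrite ?mul1r // -exprMn mulrCA.
Qed.

Lemma part_sum_cons l y j0 (r : R) : j0 \notin l ->
  part_sum (j0 :: l) (fun j => if j == j0 then r * y j else y j) be =
  \sum_(m < (\sum_(j in l) be j + be j0).+1) part_sum l y (set_at be j0 m) * r ^+ m.
Proof.
move=> jl; rewrite /part_sum; set M := (_ + _)%N.
have tot := sum_fixed_columns jl.
set K := (\sum_(j | (j \notin l) && (j != j0)) be j)%N in tot.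
have cM a : rows_ok a && [forall j, (j \in j0 :: l) || (colsum a j == be j)] ->
    (colsum a j0 <= M)%N.
  move=> /andP[ra /forallP ca].
  have := sum_free_columns l ra; rewrite tot [X in (_ + X)%N](bigD1 j0) //=.
  rewrite [X in (_ + (_ + X))%N](eq_bigr be) => [|j /andP[jl' jj0]]; last first.
    by have := ca j; rewrite inE (negPf jl') (negPf jj0) => /eqP.
  by rewrite -/K => h; rewrite -(leq_add2r K) /M -addnA -h leq_addl.
(* The column sum at [j0] is at most [M], so [inord] does not alter it. *)
rewrite (partition_big (fun a => inord (colsum a j0) : 'I_M.+1) xpredT) //=.
apply: eq_bigr => m _; rewrite mulr_suml; apply: eq_big => [a|a /andP[/cM ca /eqP <-]].
  apply/idP/idP.
    move=> /andP[H /eqP hm]; have cm : colsum a j0 = m by rewrite -hm inordK // ltnS cM.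
    move: H => /andP[-> /forallP ca]; apply/forallP => j.
    have := ca j; rewrite inE /set_at; case: eqP => [->|_] //=.
    by rewrite cm eqxx orbT.
  move=> /andP[ra /forallP ca].
  have cm : colsum a j0 = m.
    by have := ca j0; rewrite (negPf jl) /set_at eqxx => /eqP.
  rewrite ra /= cm inord_val eqxx andbT; apply/forallP => j.
  by have := ca j; rewrite inE /set_at; case: (eqVneq j j0) => //= _.
by rewrite weight_wt_at inordK ?ltnS // mulrC.
Qed.

(* The total is fixed by the rows, so freeing a first column costs nothing. *)
Lemma part_sum1 y j1 : part_sum [:: j1] y be = part_sum [::] y be.
Proof.
apply: eq_bigl => a; case ra : (rows_ok a) => //=.
apply/forallP/forallP => ca j; last by rewrite ca orbT.
have := ca j; rewrite !inE; have [->|//] := eqVneq j j1; move=> _ /=.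
have := sum_free_columns [:: j1] ra.
rewrite (bigD1 j1 (erefl : xpredT j1)) /= (eq_bigl (pred1 j1)) => [|k]; last by rewrite inE.
rewrite big_pred1_eq (eq_big (fun k => k != j1) be) => [/eqP|k|k]; rewrite ?inE //.
  by rewrite eqn_add2r.
by move=> kj; have := ca k; rewrite inE (negPf kj) => /eqP.
Qed.

(** Columns are freed one at a time with [one_variable], which rescales [y j0] and costs the factor
    [e^(h (be j0))]; the column [j1], freed first, costs nothing. *)
Lemma column_bound l j1 (d : R) : uniq (l ++ [:: j1]) -> 0 < d ->
  exists2 y : J -> R, (forall j, 0 < y j) &
    part_sum (l ++ [:: j1]) y be <=
      (\prod_(j <- l) expR (hfun (be j)%:R)) * (\prod_j y j ^+ be j)
      * (part_sum [::] (fun=> 1) be + d).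
Proof.
elim: l d => [|j0 l IHl] d.
  move=> _ d0; exists (fun=> 1) => [j|]; first exact: ltr01.
  rewrite part_sum1 big_nil mul1r big1 ?mul1r ?lerDl ?ltW // => j _.
  by rewrite expr1n.
rewrite cat_cons; set l' := l ++ [:: j1] in IHl *.
move=> /andP[jl ul] d0; have d20 : 0 < d / 2 by rewrite divr_gt0.
have [y y0 hy] := IHl _ ul d20.
set P := \prod_(j <- l) _ in hy; set Y := \prod_j _ in hy; set T := part_sum [::] _ _ in hy *.
have P0 : 0 < P by apply: prodr_gt0 => j _; exact: expR_gt0.
have Y0 : 0 < Y by apply: prodr_gt0 => j _; rewrite exprn_gt0.
have yge0 j : 0 <= y j by exact: ltW.
(* Half of [d] goes to the induction hypothesis; the other half, scaled by the accumulated factor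
   [P * Y], goes to this column. *)
have d'0 : 0 < P * Y * (d / 2) by rewrite !mulr_gt0.
have [r r0 hr] := one_variable (fun m _ => part_sum_ge0 l' (set_at be j0 m) yge0)
  (part_sum_slc yge0 jl) (leq_addl _ _) d'0.
exists (fun j => if j == j0 then r * y j else y j) => [j|].
  by case: ifP => _ //; rewrite mulr_gt0.
rewrite part_sum_cons //; apply: (le_trans hr).
have -> : part_sum l' y (set_at be j0 (be j0)) = part_sum l' y be.
  by congr part_sum; apply: funext => j; rewrite /set_at; case: eqP => [->|].
have -> : \prod_j (if j == j0 then r * y j else y j) ^+ be j = r ^+ be j0 * Y.
  rewrite /Y (bigD1 j0) //= [in RHS](bigD1 j0) //= eqxx exprMn -!mulrA; congr (_ * (_ * _)).
  by apply: eq_bigr => j /negPf ->.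
rewrite big_cons -/P.
have h : part_sum l' y be + P * Y * (d / 2) <= P * Y * (T + d).
  apply: (le_trans (lerD hy (lexx _))); rewrite -mulrDr.
  by rewrite le_eqVlt; apply/orP; left; apply/eqP; field.
have := ler_wpM2l (mulr_ge0 (expR_ge0 (hfun (be j0)%:R)) (exprn_ge0 (be j0) (ltW r0))) h.
by congr (_ <= _); ring.
Qed.

End ColumnBound.

(** * Bounds for contingency tables *)

Section Gibbs.
Variables (R : realType) (E : finType) (B : nat).
Local Notation table := {ffun E -> 'I_B.+1}.

(* The uniform law on [P] has entropy [ln #|P|]; Gibbs' inequality against the
   product of geometric laws with the same means bounds it by [\sum_e h]. *)
Lemma card_le_entropy (P : pred table) (m : E -> R) :
  (forall e, \sum_(a | P a) (a e)%:R = #|P|%:R * m e) ->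
  #|P|%:R <= expR (\sum_e hfun (m e)).
Proof.
move=> mE; set K : R := #|P|%:R.
have [K0|K0] := leqP #|P| 0.
  by rewrite /K (_ : #|P| = 0%N) ?expR_ge0 //; lia.
have Kp : 0 < K by rewrite ltr0n.
have m0 e : 0 <= m e.
  by rewrite -(pmulr_rge0 _ Kp) -mE; apply: sumr_ge0.
have m1 e : 0 < m e + 1 by rewrite ltr_wpDl.
pose t e := m e / (m e + 1).
have t0 e : 0 <= t e by rewrite divr_ge0 // ltW.
have t1 e : 1 - t e = (m e + 1)^-1 by rewrite /t; field; rewrite gt_eqF.
have t1p e : 0 < 1 - t e by rewrite t1 invr_gt0.
pose L (a : table) := \sum_e (ln (1 - t e) + (a e)%:R * ln (t e)).
have qL a : P a -> expR (L a) = \prod_e ((1 - t e) * t e ^+ a e).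
  move=> Pa; rewrite expR_sum; apply: eq_bigr => e _.
  rewrite expRD lnK ?posrE // expRM_natl; congr (_ * _).
  (* Where the mean is 0, every table in [P] vanishes at [e], so the default value of [ln 0] is
     harmless. *)
  have [me|me] := eqVneq (m e) 0.
    suff -> : a e = 0%N :> nat by rewrite !expr0.
    have := mE e; rewrite me mulr0 => /eqP; rewrite psumr_eq0 //.
    move=> /allP /(_ a); rewrite mem_index_enum Pa => /(_ isT).
    by rewrite pnatr_eq0 => /eqP.
  by rewrite lnK // posrE divr_gt0 // lt_def me m0.
(* [expR (L a)] is the mass of [a] under the product of geometric laws. *)
have sq : \sum_(a | P a) expR (L a) <= 1.
  apply: (@le_trans _ _ (\sum_(a : table) \prod_e ((1 - t e) * t e ^+ a e))).
    rewrite big_mkcond; apply: ler_sum => a _; case: ifP => [/qL -> //|_].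
    by apply: prodr_ge0 => e _; rewrite mulr_ge0 ?exprn_ge0 // ltW.
  rewrite -(bigA_distr_bigA (fun e (b : 'I_B.+1) => (1 - t e) * t e ^+ b)).
  apply: prodr_ile1 => e _; rewrite -mulr_sumr mulr_ge0 ?(ltW (t1p e)) //=; last first.
    by apply: sumr_ge0 => b _; rewrite exprn_ge0.
  have te1 : t e < 1 by rewrite -subr_gt0.
  rewrite mulrC -ler_pdivlMr // mul1r; exact: geometric_le.
(* Gibbs' inequality, from [1 + u <= e^u] at [u = ln K + L a]. *)
have lnP : \sum_(a | P a) (1 + (ln K + L a)) <= K.
  apply: (@le_trans _ _ (\sum_(a | P a) K * expR (L a))); last first.
    by rewrite -mulr_sumr ger_pMr.
  apply: ler_sum => a _; rewrite -{2}(@lnK _ K) ?posrE // -expRD.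
  exact: expR_ge1Dx.
have SL : \sum_(a | P a) L a = - (K * \sum_e hfun (m e)).
  rewrite /L exchange_big /= mulr_sumr -sumrN; apply: eq_bigr => e _.
  rewrite big_split /= -mulr_suml mE sumr_const -/K -mulr_natl -/K.
  have -> : hfun (m e) = - (ln (1 - t e) + m e * ln (t e)).
    rewrite t1 lnV ?posrE // /hfun /t.
    have [me|me] := eqVneq (m e) 0; first by rewrite me !mul0r add0r; ring.
    by rewrite ln_div ?posrE // ?lt_def ?me ?m0 //; ring.
  ring.
set S := \sum_e hfun (m e) in SL *.
move: lnP; rewrite !big_split /= SL !sumr_const -mulr_natl -/K mulr1 => h.
rewrite -[leLHS]lnK ?posrE // ler_expR.
rewrite -(ler_pM2l Kp) mulr_natl; move: h; lra.
Qed.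

End Gibbs.

(** * Lower bound on the number of contingency tables *)

Section TableBounds.
Variables (R : realType) (I J : finType) (B : nat) (W : I -> J -> bool).
Variables (al : I -> nat) (be : J -> nat).
Hypothesis al_be : (\sum_i al i = \sum_j be j)%N.
Hypothesis al_B : (\sum_i al i <= B)%N.
Local Notation table := {ffun I * J -> 'I_B.+1}.
Local Notation w := (fun i j => (W i j)%:R : R).

Definition contingency (a : table) : bool :=
  [&& rows_ok al a, [forall j, colsum a j == be j]
    & [forall e, W e.1 e.2 || (a e == ord0)]].

Lemma part_sum_card :
  part_sum B w al [::] (fun=> 1) be = #|contingency|%:R :> R.
Proof.
rewrite /part_sum -sum1_card natr_sum big_mkcond [RHS]big_mkcond.
apply: eq_bigr => a _ /=; rewrite unfold_in /contingency.
case: (rows_ok al a) => //=; rewrite (eq_forallb (P2 := fun j => colsum a j == be j)) //.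
case: [forall j, _] => //=; rewrite /weight /wt.
case: ifP => [/forallP h|/negbT/forallPn[e]].
  apply: big1 => e _; rewrite mulr1.
  by have /orP[->|/eqP ->] := h e; rewrite ?expr1n ?expr0.
rewrite negb_or => /andP[/negPf We ae]; rewrite (bigD1 e) //= We mul0r expr0n.
by rewrite (_ : (a e == 0%N :> nat) = false) ?mul0r //; exact: negPf ae.
Qed.

(** With every column free the rows are independent, so the sum factors. *)
Lemma part_sum_rows (y : J -> R) (l : seq J) : (forall j, j \in l) ->
  part_sum B w al l y be = \prod_i hom_sum B (fun j => w i j * y j) (al i).
Proof.
move=> lT; rewrite /hom_sum.
under [RHS]eq_bigr => i _ do rewrite big_mkcond.
rewrite (bigA_distr_bigA (fun i (b : {ffun J -> 'I_B.+1}) =>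
  if (\sum_j b j == al i)%N then weight (fun j => w i j * y j) b else 0)).
pose curry (a : table) := [ffun i => [ffun j => a (i, j)]].
pose uncurry (f : {ffun I -> {ffun J -> 'I_B.+1}}) : table := [ffun e => f e.1 e.2].
rewrite [RHS](reindex curry) /=; last first.
  exists uncurry => [a _|f _]; first by apply/ffunP => -[i j]; rewrite !ffunE.
  by apply/ffunP => i; apply/ffunP => j; rewrite !ffunE.
rewrite /part_sum big_mkcond; apply: eq_bigr => a _.
have -> : [forall j, (j \in l) || (colsum a j == be j)] by apply/forallP => j; rewrite lT.
have rE i : (\sum_j curry a i j = rowsum a i)%N.
  by rewrite rowsumE; apply: eq_bigr => j _; rewrite !ffunE.
rewrite andbT; case: ifP => [/forallP ra|/negbT/forallPn[i ri]].
  rewrite (eq_bigr (fun i => \prod_j wt w y (i, j) ^+ a (i, j))) => [|i _].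
    by rewrite pair_bigA; apply: eq_bigr => -[].
  by rewrite rE ra; apply: eq_bigr => j _; rewrite !ffunE.
by rewrite (bigD1 i) //= rE (negPf ri) mul0r.
Qed.

(** [column_bound] compares the number of tables with the sum over tables with free columns, which
    [row_bound] bounds below row by row. The powers of [y] cancel because [m] has column sums
    [be]. *)
Lemma table_lower (m : I -> J -> R) (j1 : J) :
  (forall i j, 0 <= m i j) -> (forall i j, ~~ W i j -> m i j = 0) ->
  (forall i, \sum_j m i j = (al i)%:R) -> (forall j, \sum_i m i j = (be j)%:R) ->
  expR (\sum_i \sum_j hfun (m i j)) <=
    (\prod_i expR (hfun (al i)%:R)) * (\prod_(j | j != j1) expR (hfun (be j)%:R))
    * #|contingency|%:R.
Proof.
move=> m0 mW mr mc; set X := expR _; set A := \prod_i _; set C := \prod_(j | _) _.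
have A0 : 0 < A by apply: prodr_gt0 => i _; exact: expR_gt0.
have C0 : 0 < C by apply: prodr_gt0 => i _; exact: expR_gt0.
have AC0 : 0 < A * C by rewrite mulr_gt0.
rewrite mulrC -ler_pdivrMr //; apply/ler_addgt0Pr => d d0.
rewrite ler_pdivrMr // -part_sum_card.
have w0 i j : 0 <= w i j by rewrite ler0n.
pose l := rem j1 (enum J).
have lE j : j \in l ++ [:: j1].
  by rewrite mem_cat mem_rem_uniq ?enum_uniq // !inE mem_enum andbT; case: eqP.
have ul : uniq (l ++ [:: j1]).
  by rewrite cats1 rcons_uniq rem_uniq ?enum_uniq // mem_rem_uniq ?enum_uniq // !inE eqxx.
have [y y0 hy] := column_bound w0 al_be al_B ul d0.
have Y0 : 0 < \prod_j y j ^+ be j by apply: prodr_gt0 => j _; rewrite exprn_gt0.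
have {}hy := le_trans _ hy.
rewrite -(ler_pM2r Y0).
have -> : (part_sum B w al [::] (fun=> 1) be + d) * (A * C) * \prod_j y j ^+ be j =
  A * (C * \prod_j y j ^+ be j * (part_sum B w al [::] (fun=> 1) be + d)) by ring.
have -> : C = \prod_(j <- l) expR (hfun (be j)%:R).
  by rewrite /l rem_filter ?enum_uniq // big_filter big_enum_cond.
apply: le_trans (ler_wpM2l (ltW A0) (hy _ (lexx _))).
rewrite part_sum_rows //.
rewrite /A -big_split /=.
have -> : X * \prod_j y j ^+ be j =
    \prod_i expR (\sum_j (hfun (m i j) + m i j * ln (w i j * y j))).
  have -> : \prod_j y j ^+ be j = expR (\sum_i \sum_j m i j * ln (y j)).
    rewrite exchange_big expR_sum; apply: eq_bigr => j _ /=.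
    by rewrite -mulr_suml mc expRM_natl lnK // posrE.
  rewrite -expRD -big_split expR_sum; apply: eq_bigr => i _ /=; congr expR.
  rewrite -big_split; apply: eq_bigr => j _ /=.
  by case wij : (W i j); rewrite ?mul1r // mW ?wij // !mul0r.
apply: ler_prod => i _; rewrite expR_ge0 /=; apply: row_bound => //.
- by move=> j; rewrite mulr_ge0 // ltW.
- move=> j /eqP; rewrite mulf_eq0 [y j == 0]gt_eqF // orbF pnatr_eq0 eqb0.
  exact: mW.
- by apply: leq_trans al_B; rewrite (bigD1 i) //= leq_addr.
Qed.

End TableBounds.

(** * Flows as tables *)

Section FlowTables.
Variables (R : realType) (p : nat) (N : 'I_p.+2 -> int).
Local Notation vertex := 'I_p.+2.
Implicit Types (f : {ffun vertex * vertex -> R}) (i j : 'I_p.+1).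

(* Row [i] of a table is the vertex [i] as a tail, column [j] the vertex [j + 1]
   as a head; the cell [(j + 1, j)] holds the slack of the vertex [j + 1]. *)
Definition tail i : vertex := widen_ord (leqnSn _) i.
Definition head j : vertex := lift ord0 j.

Definition slack f (v : vertex) : R := \sum_(k : vertex | (k < v)%N) ((N k)%:~R - f (k, v)).

Definition cell f i j : R :=
  if (i <= j)%N then f (tail i, head j) else if i == j.+1 :> nat then slack f (tail i) else 0.

Lemma sum_after i (g : vertex -> R) :
  \sum_(j : vertex | (tail i < j)%N) g j = \sum_(j : 'I_p.+1 | (i <= j)%N) g (head j).
Proof.
rewrite big_mkcond big_ord_recl /= add0r [RHS]big_mkcond.
by apply: eq_bigr => j _; rewrite /bump add1n ltnS.
Qed.

Lemma sum_before (m : nat) (g : vertex -> R) : (m <= p.+1)%N ->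
  \sum_(k : vertex | (k < m)%N) g k = \sum_(k : 'I_p.+1 | (k < m)%N) g (tail k).
Proof.
move=> mp; rewrite big_mkcond big_ord_recr /= ltnNge mp addr0 [RHS]big_mkcond.
by apply: eq_bigr.
Qed.

(** A general [g] with [g 0 = 0] serves both the row sums ([g = id]) and the entropy
    ([g = hfun]). *)
Lemma sum_cell (g : R -> R) f i : g 0 = 0 ->
  \sum_j g (cell f i j) = \sum_(j : vertex | (tail i < j)%N) g (f (tail i, j))
    + (if (0 < i)%N then g (slack f (tail i)) else 0).
Proof.
move=> g0; rewrite sum_after (bigID (fun j : 'I_p.+1 => (i <= j)%N)) /=; congr (_ + _).
  by apply: eq_bigr => j ij; rewrite /cell ij.
case: ifP => i0; last first.
  by apply: big1 => j; rewrite -ltnNge => ji; exfalso; lia.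
have ip : (i.-1 < p.+1)%N by have := ltn_ord i; lia.
rewrite (bigD1 (Ordinal ip)) /=; last by lia.
have -> : cell f i (Ordinal ip) = slack f (tail i).
  by rewrite /cell /= ifF ?ifT //; lia.
rewrite big1 ?addr0 // => j /andP[ij ji].
rewrite /cell (negPf ij) (_ : (i == j.+1 :> nat) = false) //.
by apply/eqP => e; move/eqP: ji; apply; apply: val_inj => /=; lia.
Qed.

Lemma sum_le_last (m : nat) (g : vertex -> R) (v : vertex) : v = m :> nat ->
  \sum_(k : vertex | (k <= m)%N) g k = \sum_(k : vertex | (k < v)%N) g k + g v.
Proof.
move=> vm; rewrite (bigD1 v) /= ?vm // addrC; congr (_ + _); apply: eq_bigl => k.
by rewrite -vm ltn_neqAle andbC.
Qed.

Lemma spartE (m : nat) : (spart N m)%:~R = \sum_(k : vertex | (k <= m)%N) (N k)%:~R :> R.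
Proof. by rewrite /spart rmorph_sum. Qed.

Section OneFlow.
Variable f : {ffun vertex * vertex -> R}.
Hypothesis fN : netflow_ok N f.

Lemma netflowE v : (N v)%:~R =
  \sum_(j : vertex | (v < j)%N) f (v, j) - \sum_(k : vertex | (k < v)%N) f (k, v).
Proof. by case: fN => _ [_ ->]. Qed.

Lemma flow_ge0 u v : 0 <= f (u, v).
Proof.
case: fN => f0 [fp _]; have [uv|uv] := boolP (u < v)%N; first exact: fp.
by rewrite f0.
Qed.

(** Edges inside the initial segment cancel, which leaves those crossing the cut. *)
Lemma cut_flow (m : nat) :
  \sum_(k : vertex | (k < m)%N) (N k)%:~R =
    \sum_(k : vertex | (k < m)%N) \sum_(j : vertex | (m <= j)%N) f (k, j).
Proof.
under eq_bigr => k _ do rewrite netflowE.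
rewrite sumrB.
have -> : \sum_(k : vertex | (k < m)%N) \sum_(l : vertex | (l < k)%N) f (l, k) =
    \sum_(k : vertex | (k < m)%N) \sum_(j : vertex | (k < j)%N && (j < m)%N) f (k, j).
  rewrite (exchange_big_dep (fun l : vertex => (l < m)%N)) /=; last by lia.
  by apply: eq_bigr => l lm; apply: eq_bigl => j; rewrite andbC.
rewrite -sumrB; apply: eq_bigr => k km.
rewrite (bigID (fun j : vertex => (j < m)%N)) /= addrAC subrr add0r.
by apply: eq_bigl => j; lia.
Qed.

Lemma total_netflow : \sum_k (N k)%:~R = 0 :> R.
Proof.
have := cut_flow p.+2; rewrite [X in _ = X]big1 => [e|k _]; last first.
  by apply: big_pred0 => j; rewrite leqNgt ltn_ord.
by rewrite -[RHS]e; apply: eq_bigl => k; rewrite ltn_ord.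
Qed.

(** By [cut_flow] the slack is the flow that jumps over [v]. *)
Lemma slack_ge0 v : 0 <= slack f v.
Proof.
rewrite /slack sumrB cut_flow -sumrB; apply: sumr_ge0 => k kv.
rewrite (bigD1 v) //= addrAC subrr add0r.
by apply: sumr_ge0 => j _; exact: flow_ge0.
Qed.

Lemma cell_ge0 i j : 0 <= cell f i j.
Proof.
by rewrite /cell; case: ifP => _; [exact: flow_ge0|case: ifP => _ //; exact: slack_ge0].
Qed.

Lemma cell_row i : \sum_j cell f i j = (spart N i)%:~R.
Proof.
rewrite (sum_cell (g := id)) // spartE (sum_le_last _ (v := tail i)) // netflowE.
have -> : (if (0 < i)%N then slack f (tail i) else 0) = slack f (tail i).
  case: posnP => // i0; rewrite /slack big_pred0 // => k.
  by rewrite /= i0.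
rewrite /slack sumrB; ring.
Qed.

Lemma cell_col_before j :
  \sum_(i : 'I_p.+1) cell f i j = \sum_(k : vertex | (k < head j)%N) f (k, head j)
    + \sum_(i : 'I_p.+1 | i == j.+1 :> nat) slack f (tail i).
Proof.
rewrite sum_before ?lift0 ?ltn_ord // (bigID (fun i : 'I_p.+1 => (i <= j)%N)) /=.
congr (_ + _); first by apply: eq_big => i //=; rewrite /cell => ->.
rewrite [RHS]big_mkcond [LHS]big_mkcond; apply: eq_bigr => i _; rewrite /cell.
have [ij|//] := leqP i j; rewrite (_ : (i == j.+1 :> nat) = false) //; lia.
Qed.

Lemma cell_col j : \sum_(i : 'I_p.+1) cell f i j = (spart N j)%:~R.
Proof.
rewrite cell_col_before spartE; have [jp|jp] := ltnP j.+1 p.+1.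
  rewrite (big_pred1 (Ordinal jp)) => [|i]; last by apply/eqP/eqP => [e|->]; first exact: val_inj.
  have -> : tail (Ordinal jp) = head j by apply: val_inj; rewrite /= /bump add1n.
  rewrite /slack sumrB addrC subrK; apply: eq_bigl => k.
  by rewrite lift0 ltnS.
(* The last column has no slack cell: its sum is the inflow of the last vertex, which the zero total
   netflow identifies. *)
rewrite [X in _ + X]big_pred0 ?addr0 => [|i]; last first.
  by apply/negP => /eqP e; have := ltn_ord i; lia.
have jE : head j = ord_max by apply: val_inj; rewrite /= /bump add1n; have := ltn_ord j; lia.
have out0 : \sum_(k : vertex | (head j < k)%N) f (head j, k) = 0.
  by apply: big_pred0 => k; rewrite jE /= ltnNge -ltnS ltn_ord.
have := total_netflow; rewrite (bigD1 (head j)) //= netflowE out0.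
rewrite sub0r addrC => /eqP; rewrite subr_eq0 => /eqP <-.
apply: eq_bigl => k; rewrite -val_eqE /= /bump add1n.
have := ltn_ord k; have := ltn_ord j; lia.
Qed.

Lemma flow_entropyE : flow_entropy N f = \sum_i \sum_j hfun (cell f i j).
Proof.
under [RHS]eq_bigr => i _ do rewrite (sum_cell _ _ (hfun0 R)).
rewrite big_split /= /flow_entropy; congr (_ + _).
  rewrite big_ord_recr /= [X in _ + X]big_pred0 ?addr0 // => k.
  by apply/negP; rewrite /= ltnNge -ltnS ltn_ord.
rewrite big_mkcond big_ord_recr /= ltnn addr0; apply: eq_bigr => i _ /=.
by rewrite ltn_ord andbT.
Qed.

End OneFlow.
End FlowTables.

(** * From tables back to flows, and the count of integer flows *)

Section TableFlows.
Variables (R : realType) (p : nat) (N : 'I_p.+2 -> int).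
Local Notation vertex := 'I_p.+2.
Implicit Types (i j : 'I_p.+1).

(** Generic in [T], so that it applies to real and to integer tables; on an edge, [inord e.1] and
    [inord e.2.-1] invert [tail] and [head]. *)
Definition flow_of (T : Type) (zero : T) (A : 'I_p.+1 -> 'I_p.+1 -> T) :
    {ffun vertex * vertex -> T} :=
  [ffun e : vertex * vertex => if (e.1 < e.2)%N then A (inord e.1) (inord e.2.-1) else zero].

Lemma flow_of_cell (T : Type) (zero : T) A i j :
  flow_of zero A (tail i, head j) = if (i <= j)%N then A i j else zero.
Proof. by rewrite ffunE /= /bump add1n ltnS /= !inord_val. Qed.

Section RealTable.
Variable A : 'I_p.+1 -> 'I_p.+1 -> R.
Hypothesis A0 : forall i j, 0 <= A i j.
Hypothesis supp : forall i j, ~~ (i <= j.+1)%N -> A i j = 0.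
Hypothesis rowA : forall i, \sum_j A i j = (spart N i)%:~R.
Hypothesis colA : forall j, \sum_i A i j = (spart N j)%:~R.
Hypothesis N0 : \sum_k (N k)%:~R = 0 :> R.

Lemma out_flow_of i : \sum_(j : vertex | (tail i < j)%N) flow_of 0 A (tail i, j) =
  \sum_(j : 'I_p.+1 | (i <= j)%N) A i j.
Proof. by rewrite sum_after; apply: eq_bigr => j ij; rewrite flow_of_cell ij. Qed.

Lemma in_flow_of j : \sum_(k : vertex | (k < head j)%N) flow_of 0 A (k, head j) =
  \sum_(i : 'I_p.+1 | (i <= j)%N) A i j.
Proof.
rewrite sum_before ?lift0 ?ltn_ord //; apply: eq_bigr => i.
by rewrite ltnS => ij; rewrite flow_of_cell ij.
Qed.

Lemma sum_below i j : i = j.+1 :> nat -> \sum_(k : 'I_p.+1 | ~~ (k <= j)%N) A k j = A i j.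
Proof.
move=> ij; rewrite (bigD1 i) /=; last by lia.
rewrite big1 ?addr0 // => k /andP[jk /eqP ki].
by rewrite supp //; apply/negP => h; apply: ki; apply: val_inj => /=; lia.
Qed.

Lemma sum_left i j : i = j.+1 :> nat -> \sum_(k : 'I_p.+1 | ~~ (i <= k)%N) A i k = A i j.
Proof.
move=> ij; rewrite (bigD1 j) /=; last by lia.
rewrite big1 ?addr0 // => k /andP[jk /eqP kj].
by rewrite supp //; apply/negP => h; apply: kj; apply: val_inj => /=; lia.
Qed.

Lemma spart_succ i j : i = j.+1 :> nat ->
  (spart N i)%:~R = (spart N j)%:~R + (N (tail i))%:~R :> R.
Proof.
move=> ij; rewrite !spartE (sum_le_last _ (v := tail i)) //; congr (_ + _).
by apply: eq_bigl => k; rewrite /= ij ltnS.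
Qed.

Lemma tail_head i j : i = j.+1 :> nat -> tail i = head j.
Proof. by move=> ij; apply: val_inj; rewrite /= /bump add1n. Qed.

(** The column sum determines the subdiagonal cell from the entries on and above the diagonal. *)
Lemma slack_flow_of i j : i = j.+1 :> nat -> slack N (flow_of 0 A) (tail i) = A i j.
Proof.
move=> ij; rewrite /slack sumrB (tail_head ij) in_flow_of.
have -> : \sum_(k : vertex | (k < head j)%N) (N k)%:~R = (spart N j)%:~R :> R.
  by rewrite spartE; apply: eq_bigl => k; rewrite lift0 ltnS.
rewrite -colA (bigID (fun k : 'I_p.+1 => (k <= j)%N)) /= (sum_below ij).
by rewrite addrAC subrr add0r.
Qed.

Lemma cell_flow_of i j : cell N (flow_of 0 A) i j = A i j.
Proof.
rewrite /cell flow_of_cell; have [//|ij] := leqP i j.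
case: (nat_of_ord i =P j.+1) => [ij1|ij1]; first exact: slack_flow_of.
by rewrite supp //; lia.
Qed.

(** At an inner vertex, the subdiagonal cell read from its row cancels against the same cell read as
    slack. The last vertex has only inflow, and [N0] gives its netflow. *)
Lemma flow_of_ok : netflow_ok N (flow_of 0 A).
Proof.
split; first by move=> u v uv; rewrite ffunE /= (negPf uv).
split; first by move=> u v uv; rewrite ffunE /= uv.
move=> v; have [vp|vp] := ltnP v p.+1; last first.
  have vE : v = head ord_max.
    by apply: val_inj; rewrite /= /bump add1n; have := ltn_ord v; lia.
  rewrite vE in_flow_of big_pred0 => [|k]; last first.
    by rewrite lift0 ltnNge -ltnS ltn_ord.
  have := N0; rewrite (bigD1 (head ord_max)) //= => /eqP.
  rewrite addrC addr_eq0 => /eqP e; rewrite sub0r.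
  apply/eqP; rewrite eqr_oppLR; apply/eqP; rewrite -[RHS]e.
  have -> : \sum_(k | k != head ord_max) (N k)%:~R = (spart N (ord_max : 'I_p.+1))%:~R :> R.
    rewrite spartE; apply: eq_bigl => k; rewrite -val_eqE /= /bump add1n.
    by have := ltn_ord k; lia.
  by rewrite -colA; apply: eq_bigl => k; rewrite -ltnS ltn_ord.
have [i ->] : exists i : 'I_p.+1, v = tail i by exists (Ordinal vp); exact: val_inj.
rewrite out_flow_of.
have := rowA i; rewrite (bigID (fun j : 'I_p.+1 => (i <= j)%N)) /=.
have [i0|i0] := posnP i.
  rewrite [X in _ + X]big1 => [|j]; last by rewrite i0.
  rewrite addr0 => ->; rewrite [X in _ - X]big_pred0 => [|k]; last by rewrite /= i0.
  rewrite subr0 spartE (sum_le_last _ (v := tail i)) // big_pred0 ?add0r // => k.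
  by rewrite /= i0.
have jp : (i.-1 < p.+1)%N by have := ltn_ord i; lia.
have ij : i = (Ordinal jp).+1 :> nat by rewrite /=; lia.
rewrite (sum_left ij) (spart_succ ij) => h.
have := slack_flow_of ij; rewrite /slack sumrB.
have -> : \sum_(k : vertex | (k < tail i)%N) (N k)%:~R = (spart N (Ordinal jp))%:~R :> R.
  by rewrite spartE; apply: eq_bigl => k; rewrite /= [X in (_ < X)%N]ij ltnS.
move: h; lra.
Qed.

End RealTable.

Local Notation sp := (fun i : 'I_p.+1 => `|spart N i|%N).
Local Notation B := (\sum_i sp i)%N.
Local Notation table := {ffun 'I_p.+1 * 'I_p.+1 -> 'I_B.+1}.

Definition int_flow (a : table) : {ffun vertex * vertex -> int} :=
  flow_of 0 (fun i j => (a (i, j) : nat)%:Z).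

Definition tables : pred table :=
  contingency (fun i j => (i <= j.+1)%N) sp sp.

Lemma int_flowE a :
  [ffun e => (int_flow a e)%:~R : R] = flow_of 0 (fun i j => (a (i, j))%:R : R).
Proof. by apply/ffunP => e; rewrite !ffunE; case: ifP. Qed.

Hypothesis flowsN : @flows R p.+1 N !=set0.

Lemma total_netflow0 : \sum_k (N k)%:~R = 0 :> R.
Proof. by case: flowsN => f fN; exact: total_netflow fN. Qed.

(** A partial sum is a row sum of the nonnegative table of some flow, so the absolute value in [sp]
    changes nothing. *)
Lemma sp_natr i : (sp i)%:R = (spart N i)%:~R :> R.
Proof.
have [f fN] := flowsN; have : 0 <= (spart N i)%:~R :> R.
  by rewrite -(cell_row fN); apply: sumr_ge0 => j _; exact: cell_ge0.
by rewrite ler0z -[RHS]/(_%:~R) => h; rewrite -[in RHS](gez0_abs h).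
Qed.

Lemma tables_row a i : a \in tables -> \sum_j (a (i, j))%:R = (spart N i)%:~R :> R.
Proof.
by move=> /and3P[/forallP /(_ i) /eqP ra _ _]; rewrite -sp_natr -ra rowsumE natr_sum.
Qed.

Lemma tables_col a j : a \in tables -> \sum_i (a (i, j))%:R = (spart N j)%:~R :> R.
Proof.
by move=> /and3P[_ /forallP /(_ j) /eqP ca _]; rewrite -sp_natr -ca colsumE natr_sum.
Qed.

Lemma tables_supp a i j : a \in tables -> ~~ (i <= j.+1)%N -> a (i, j) = ord0.
Proof.
by move=> /and3P[_ _ /forallP /(_ (i, j)) /= /orP[->//|/eqP]].
Qed.

Lemma int_flow_inj : {in tables &, injective int_flow}.
Proof.
move=> a a' ta ta' e; apply/ffunP => -[i j]; apply/val_inj/eqP.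
rewrite -(eqr_nat R); apply/eqP.
have cE b : b \in tables ->
    cell N (flow_of 0 (fun i j => (b (i, j))%:R : R)) i j = (b (i, j))%:R.
  move=> tb; apply: cell_flow_of => [k l kl|l]; first by rewrite tables_supp.
  exact: tables_col.
by rewrite -[LHS]cE // -[RHS]cE // -!int_flowE e.
Qed.

Lemma flows_int_flow a : a \in tables -> flows N [ffun e => (int_flow a e)%:~R : R].
Proof.
move=> ta; rewrite int_flowE; apply: flow_of_ok => [//|i j ij|i|j|].
- by rewrite tables_supp.
- exact: tables_row.
- exact: tables_col.
- exact: total_netflow0.
Qed.

Lemma int_flow_surj (g : {ffun vertex * vertex -> int}) :
  flows N [ffun e => (g e)%:~R : R] -> exists2 a, a \in tables & g = int_flow a.
Proof.
set f := finfun _ => fN.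
(* The integer form of [cell]; its entries are bounded by the row sums, hence fit below [B]. *)
pose z i j : int := if (i <= j)%N then g (tail i, head j)
  else if i == j.+1 :> nat then \sum_(k : vertex | (k < tail i)%N) (N k - g (k, tail i)) else 0.
have zE i j : cell N f i j = (z i j)%:~R.
  rewrite /cell /z; case: ifP => _; first by rewrite ffunE.
  case: ifP => _ //; rewrite /slack rmorph_sum; apply: eq_bigr => k _.
  by rewrite ffunE rmorphB.
have z0 i j : 0 <= z i j by rewrite -(ler0z R) -zE cell_ge0.
have zN i j : (`|z i j|%N)%:R = cell N f i j by rewrite zE -[in RHS](gez0_abs (z0 i j)).
have zB i j : (`|z i j| <= B)%N.
  apply: (@leq_trans (sp i)); last by rewrite (bigD1 i) //= leq_addr.
  rewrite -(ler_nat R) zN sp_natr -(cell_row fN) (bigD1 j) //= lerDl.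
  by apply: sumr_ge0 => k _; exact: cell_ge0.
pose a : table := [ffun e => inord `|z e.1 e.2|%N].
have aE i j : a (i, j) = `|z i j|%N :> nat by rewrite ffunE inordK // ltnS.
exists a.
  apply/and3P; split; [apply/forallP => i|apply/forallP => j|apply/forallP => -[i j]].
  - rewrite rowsumE -(eqr_nat R) natr_sum sp_natr -(cell_row fN); apply/eqP.
    by apply: eq_bigr => j _; rewrite aE zN.
  - rewrite colsumE -(eqr_nat R) natr_sum sp_natr -(cell_col fN); apply/eqP.
    by apply: eq_bigr => i _; rewrite aE zN.
  - have [//|ij /=] := leqP i j.+1; apply/eqP/val_inj; rewrite /= aE /z.
    by rewrite !ifF //; lia.
apply/ffunP => -[u v]; rewrite ffunE /=; case: ifP => uv; last first.
  case: fN => f0 _; apply/eqP; rewrite -(intr_eq0 R).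
  by have := f0 u v (negbT uv); rewrite ffunE => ->.
have up : (u < p.+1)%N by have := ltn_ord v; lia.
have vp : (v.-1 < p.+1)%N by have := ltn_ord v; lia.
have uE : u = tail (inord u) by apply: val_inj; rewrite /= inordK.
have vE : v = head (inord v.-1) by apply: val_inj; rewrite /= /bump add1n inordK //; lia.
rewrite aE gez0_abs // /z !inordK // ifT; last by lia.
by rewrite -uE -vE.
Qed.

Lemma card_tables : Kn R N = #|tables|.
Proof.
rewrite /Kn; have -> : [set g : {ffun vertex * vertex -> int} | flows N [ffun e => (g e)%:~R : R]] =
    [set` [fset int_flow a | a in tables]%fset].
  apply/seteqP; split => g /=.
    by move=> /int_flow_surj[a ta ->]; apply/imfsetP; exists a.
  by move=> /imfsetP[a ta ->]; exact: flows_int_flow.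
rewrite set_fsetK card_in_imfset /=; last exact: int_flow_inj.
by rewrite cardE.
Qed.

Lemma entropy_lower f (j1 : 'I_p.+1) : flows N f ->
  expR (flow_entropy N f) <=
    (\prod_i expR (hfun ((spart N (i : 'I_p.+1))%:~R : R))) *
    (\prod_(j : 'I_p.+1 | j != j1) expR (hfun ((spart N j)%:~R : R))) * (Kn R N)%:R.
Proof.
move=> fN; rewrite card_tables flow_entropyE.
under eq_bigr => i _ do rewrite -sp_natr.
under [X in _ <= _ * X * _]eq_bigr => j _ do rewrite -sp_natr.
apply: table_lower => // [i j|i j ij|i|j].
- exact: cell_ge0.
- rewrite /cell !ifF //; lia.
- by rewrite sp_natr (cell_row fN).
- by rewrite sp_natr (cell_col fN).
Qed.

(** The average of all tables has the same margins and support, so it is the table of a flow, and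
    its entries are the means required by [card_le_entropy]. *)
Lemma entropy_upper : (0 < Kn R N)%N ->
  exists2 f, flows N f & (Kn R N)%:R <= expR (flow_entropy N f : R).
Proof.
rewrite card_tables => K0; have Kn0 : #|tables|%:R != 0 :> R by rewrite pnatr_eq0 -lt0n.
pose A i j : R := (\sum_(a | tables a) (a (i, j))%:R) / #|tables|%:R.
have A0 i j : 0 <= A i j by rewrite divr_ge0 // sumr_ge0.
have supp i j : ~~ (i <= j.+1)%N -> A i j = 0.
  move=> ij; rewrite /A big1 ?mul0r // => a ta.
  by rewrite tables_supp.
have rowA i : \sum_j A i j = (spart N i)%:~R.
  rewrite -mulr_suml exchange_big /= (eq_bigr (fun=> (spart N i)%:~R)) => [|a ta].
    by rewrite sumr_const -[X in X / _]mulr_natr mulfK.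
  exact: tables_row.
have colA j : \sum_i A i j = (spart N j)%:~R.
  rewrite -mulr_suml exchange_big /= (eq_bigr (fun=> (spart N j)%:~R)) => [|a ta].
    by rewrite sumr_const -[X in X / _]mulr_natr mulfK.
  exact: tables_col.
have fN : flows N (flow_of 0 A) := flow_of_ok A0 supp rowA colA total_netflow0.
exists (flow_of 0 A) => //; rewrite flow_entropyE.
rewrite (_ : \sum_i _ = \sum_e hfun (A e.1 e.2)).
  apply: card_le_entropy => e; rewrite mulrC divfK //.
  by apply: eq_bigr => a _; case: e.
rewrite pair_bigA; apply: eq_bigr => e _ /=.
by rewrite (cell_flow_of supp colA).
Qed.

End TableFlows.

(** * Both bounds on the number of integer flows *)

Theorem theorem1p5 (R : realType) (n : nat) (N : 'I_n.+1 -> int) :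
  (1 <= n)%N ->
  @flows R n N !=set0 ->
  let S := [set expR (flow_entropy N f) | f in @flows R n N] in
  let e := fun k : nat => expR (hfun ((spart N k)%:~R : R)) in
  sup S >= (Kn R N)%:R /\
  (Kn R N)%:R >=
    (\big[Num.max/0]_(k < n) e k) / (\prod_(k < n) e k) ^+ 2 * sup S.
Proof.
case: n N => [//|p] N _ ne S e.
have e0 k : 0 < e k by exact: expR_gt0.
(* An index attaining the maximum serves as the column freed at no cost, so that [P * Q] equals
   [P ^+ 2 / e j1]. *)
have [j1 _ maxE] := @eq_bigmax _ _ _ 0 (ord0 : 'I_p.+1) xpredT (fun k : 'I_p.+1 => e k)
  isT (fun k _ => ltW (e0 k)).
pose P := \prod_(k < p.+1) e k; have P0 : 0 < P by apply: prodr_gt0.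
pose Q := \prod_(k < p.+1 | k != j1) e k.
have PQ : P = e j1 * Q by rewrite /P (bigD1 j1).
have Q0 : 0 < Q by apply: prodr_gt0.
have lower f : flows N f -> expR (flow_entropy N f) <= P * Q * (Kn R N)%:R.
  exact: entropy_lower.
have Sne : S !=set0 by case: ne => f fN; exists (expR (flow_entropy N f)), f.
have Sub : ubound S (P * Q * (Kn R N)%:R) by move=> _ [f fN <-]; exact: lower.
(* The lower bound itself yields an integer flow, since exponentials are positive; averaging needs
   one. *)
have K0 : (0 < Kn R N)%N.
  have [f fN] := ne; rewrite lt0n; apply/eqP => K0.
  by have := lower f fN; rewrite K0 mulr0 leNgt expR_gt0.
split.
  have [f fN hf] := entropy_upper ne K0.
  apply: (le_trans hf); apply: ub_le_sup; last by exists f.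
  by exists (P * Q * (Kn R N)%:R).
have := ge_sup Sne Sub; rewrite maxE -/P => h.
have c0 : 0 <= e j1 / P ^+ 2 by rewrite divr_ge0 ?exprn_ge0 // ltW.
apply: le_trans (ler_wpM2l c0 h) _.
rewrite le_eqVlt; apply/orP; left; apply/eqP; rewrite PQ.
by field; rewrite !gt_eqF.
Qed.
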